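(* Let $A\in\mathbb{R}^{n\times n}$ be a non-singular matrix diagonalizable over $\mathbb{C}$. Then there exist a generic cut-and-project scheme $\Lambda=(\mathcal{L}\subset\mathbb{R}^s,\mathbb{R}^n)$ and a window $\Omega$ such that the cut-and-project set $\Sigma(\Omega)$ satisfies $A\Sigma(\Omega)\subset\Sigma(\Omega)$ if and only if the spectrum of $A$ has the following properties: (P1) every eigenvalue of $A$ is an algebraic integer; (P2) every complex number $\mu$ with $|\mu|>1$ which is algebraically conjugate to an eigenvalue of $A$ is itself an eigenvalue of $A$, and moreover $m_A(\mu)\geq m_A(\nu)$ for all algebraic conjugates $\nu$ of $\mu$, with strict inequality for at least one algebraic conjugate $\nu$ of $\mu$.
   Context: For a matrix $T$ and $\lambda\in\mathbb{C}$, $m_T(\lambda)$ denotes the algebraic multiplicity of $\lambda$ as an eigenvalue of $T$ ($0$ if $\lambda$ is not an eigenvalue); algebraic conjugates of an algebraic number are the roots of its minimal polynomial over $\mathbb{Q}$. A lattice $\mathcal{L}\subset\mathbb{R}^s$ is $\{L\mathbf{r}:\mathbf{r}\in\mathbb{Z}^s\}$ for a non-singular $L\in\mathbb{R}^{s\times s}$. For $1\le n<s$, the cut-and-project scheme $\Lambda=(\mathcal{L}\subset\mathbb{R}^s,\mathbb{R}^n)$ consists of $\mathcal{L}$ with projections $\pi_\parallel(\mathbf{x})=(x_1,\dots,x_n)^\top$, $\pi_\perp(\mathbf{x})=(x_{n+1},\dots,x_s)^\top$; it is generic if $\pi_\parallel|_{\mathcal{L}}$ and $\pi_\perp|_{\mathcal{L}}$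 are injective and $\pi_\perp(\mathcal{L})$ is dense in $\mathbb{R}^{s-n}$. A window is a bounded set $\Omega\subset\mathbb{R}^{s-n}$ with $\overline{\Omega^\circ}=\overline{\Omega}\neq\emptyset$, and the cut-and-project set is $\Sigma(\Omega)=\{\pi_\parallel(\mathbf{l}):\mathbf{l}\in\mathcal{L},\ \pi_\perp(\mathbf{l})\in\Omega\}$. *)

(* Defs.v *)
From HB Require Import structures.
From mathcomp Require Import all_boot all_order all_algebra.
From mathcomp Require Import all_classical all_reals all_analysis.
From mathcomp Require Import complex.
Set Implicit Arguments. Unset Strict Implicit. Unset Printing Implicit Defensive.
Import Order.TTheory GRing.Theory Num.Theory.
Import numFieldNormedType.Exports.
Local Open Scope classical_set_scope.
Local Open Scope ring_scope.

Definition cmx (R : realType) (n : nat) (A : 'M[R]_n) : 'M[R[i]]_n :=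
  map_mx (fun x : R => (x%:C)%C) A.

Definition alg_mult (C : fieldType) (n : nat) (T : 'M[C]_n) (l : C) : nat :=
  mup l (char_poly T).

Definition algebraic_integer (C : fieldType) (z : C) : Prop :=
  exists p : {poly int}, p \is monic /\ root (map_poly intr p) z.

(* nu is an algebraic conjugate of mu: nu is a root of the minimal polynomial
   of mu over Q, i.e. of the (unique) monic irreducible rational polynomial
   having mu as a root. *)
Definition alg_conjugate (C : fieldType) (mu nu : C) : Prop :=
  exists p : {poly rat}, [/\ p \is monic, irreducible_poly p,
    root (map_poly ratr p) mu & root (map_poly ratr p) nu].

Definition lattice (R : realType) (s : nat) (L : 'M[R]_s) : set 'cV[R]_s :=
  [set L *m map_mx intr r | r in [set: 'cV[int]_s]].

Definition pi_par (R : realType) (n m : nat) (x : 'cV[R]_(n + m)) : 'cV[R]_n :=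
  usubmx x.
Definition pi_perp (R : realType) (n m : nat) (x : 'cV[R]_(n + m)) : 'cV[R]_m :=
  dsubmx x.

Definition generic_cps (R : realType) (n m : nat) (L : 'M[R]_(n + m)) : Prop :=
  [/\ {in lattice L &, injective (@pi_par R n m)},
      {in lattice L &, injective (@pi_perp R n m)} &
      dense (@pi_perp R n m @` lattice L)].

Definition window (R : realType) (m : nat) (W : set 'cV[R]_m) : Prop :=
  [/\ bounded_set W, closure (interior W) = closure W & closure W !=set0].

Definition cps_set (R : realType) (n m : nat) (L : 'M[R]_(n + m))
  (W : set 'cV[R]_m) : set 'cV[R]_n :=
  [set pi_par l | l in [set l | lattice L l /\ W (pi_perp l)]].

(* Main.v *)
Require Import Defs.
From HB Require Import structures.
From mathcomp Require Import all_boot all_order all_algebra.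
From mathcomp Require Import all_classical all_reals all_analysis.
From mathcomp Require Import complex separable fieldext ring lra.
Set Implicit Arguments. Unset Strict Implicit. Unset Printing Implicit Defensive.
Import Order.TTheory GRing.Theory Num.Theory.
Import numFieldNormedType.Exports.
Local Open Scope classical_set_scope.
Local Open Scope ring_scope.

(**
Write [L = col_mx B E], so that lattice points are [(B r, E r)] with [r]
integral.

Necessity. Differences of points of [Sigma] exhaust [B Z^s], because [E Z^s] is
dense and the window contains a ball. Hence [A B = B M] for an integer matrix
[M], and the iterates [E M^k r] stay bounded uniformly for [E r] in a bounded
set. Letting [r] run along the directions killed by [E], this forces
[E M = D E], so that [M] is similar to [diag(A, D)], and all eigenvalues of [D]
have modulus at most 1. Multiplicities in the integer matrix [M] are constant on
conjugacy classes. If no conjugate of [mu] were an eigenvalue of [D], then [E]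
would kill the rational subspace [ker p(M)], where [p] is the minimal polynomial
of [mu], contradicting injectivity of [E].

Sufficiency. The properties of the spectrum allow one to choose an integer
matrix [M], a direct sum of companion matrices of minimal polynomials, whose
spectrum is that of [A] plus eigenvalues of modulus at most 1, and such that
each polynomial has a root whose multiplicity is strictly larger in [M] than in
[A]. One looks for [B] and [F] with [A B = B M], [M F = F A], [B F = 1], and
takes for [E] a basis of the left kernel of [F]. The scheme is generic as soon
as [B r <> 0], [F B r <> r] and [z F <> 0] for nonzero integral [r] and [z], the
last condition giving density by Kronecker's theorem. These are countably many
polynomial conditions, none of them identically false, on the curves
[B_0 + \sum_k t^k B_k] and [F_0 + \sum_k t^k F_k], so a suitable [t] exists.
The induced map [D] is power bounded, and [{y | forall k, |D^k y| <= 1}] is a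
window stable under it.
*)

(** * Kronecker's theorem *)

Lemma mx_norm_lt (R : realType) m n (x : 'M[R]_(m, n)) e : 0 < e ->
  (`|x| < e) <-> (forall i j, `|x i j| < e).
Proof.
move=> e0; rewrite /Num.Def.normr /= mx_normrE; split.
  by move=> /bigmax_ltP[_ H] i j; exact: (H (i, j)).
by move=> H; apply/bigmax_ltP; split => // -[i j] _; exact: H.
Qed.

Lemma mx_norm_ge (R : realType) m n (x : 'M[R]_(m, n)) i j : `|x i j| <= `|x|.
Proof. by rewrite [leRHS]/Num.Def.normr /= mx_normrE; exact: (le_bigmax _ _ (i, j)). Qed.

Lemma mx_norm_le (R : realType) m n (x : 'M[R]_(m, n)) e : 0 <= e ->
  (forall i j, `|x i j| <= e) -> `|x| <= e.
Proof.
move=> e0 H; rewrite /Num.Def.normr /= mx_normrE.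
by apply/bigmax_leP; split => // -[i j] _; exact: H.
Qed.

Lemma mulmx_norm_le (R : realType) m n p (A : 'M[R]_(m, n)) (x : 'M[R]_(n, p)) :
  `|A *m x| <= (\sum_i \sum_j `|A i j|) * `|x|.
Proof.
have sum0 i : 0 <= \sum_j `|A i j| by exact: sumr_ge0.
apply: mx_norm_le => [|i k]; first by rewrite mulr_ge0 // sumr_ge0.
rewrite mxE (le_trans (ler_norm_sum _ _ _)) //.
apply: (@le_trans _ _ ((\sum_j `|A i j|) * `|x|)).
  rewrite mulr_suml ler_sum // => j _; rewrite normrM ler_wpM2l //.
  exact: mx_norm_ge.
by rewrite ler_wpM2r // (bigD1 i) //= lerDl sumr_ge0.
Qed.

Lemma mulmx_bounded (R : realType) m n (A : 'M[R]_(m, n)) :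
  exists2 K, 0 < K & forall p (x : 'M[R]_(n, p)), `|A *m x| <= K * `|x|.
Proof.
exists (1 + \sum_i \sum_j `|A i j|) => [|p x].
  by rewrite ltr_pwDl // sumr_ge0 // => i _; rewrite sumr_ge0.
by apply: le_trans (mulmx_norm_le _ _) _; rewrite ler_wpM2r // lerDr.
Qed.

(** Pigeonhole principle: among the [K ^ m + 1] vectors of fractional parts of [a *: x], two lie in
    the same box of side [1/K], and the difference of their multipliers serves as [N]. *)
Lemma dirichlet (R : realType) m (x : 'cV[R]_m) e : 0 < e ->
  exists (N : nat) (w : 'cV[int]_m),
    (0 < N)%N /\ `|N%:R *: x - map_mx intr w| < e.
Proof.
move=> e0; pose K := (Num.truncn e^-1).+1.
have Ke : K%:R^-1 < e.
  by rewrite invf_plt ?posrE ?ltr0n // truncnS_gt.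
pose fr (a : nat) i := a%:R * x i 0 - (Num.floor (a%:R * x i 0))%:~R.
have fr01 a i : 0 <= fr a i < 1.
  rewrite /fr subr_ge0 floor_le /= ltrBlDl.
  by have := floorD1_gt (a%:R * x i 0); rewrite intrD.
have trK a i : (Num.truncn (K%:R * fr a i) < K)%N.
  have /andP[f0 f1] := fr01 a i.
  rewrite -(ltr_nat R); apply: (@le_lt_trans _ _ (K%:R * fr a i)).
    by rewrite truncn_le mulr_ge0.
  by rewrite -[ltRHS]mulr1 ltr_pM2l // ltr0n.
pose g (a : 'I_(K ^ m).+1) : {ffun 'I_m -> 'I_K} := [ffun i => Ordinal (trK a i)].
have : ~~ injectiveb g.
  apply/negP => /injectiveP /leq_card.
  by rewrite card_ffun !card_ord ltnn.
move=> /injectivePn[a [b ab gab]].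
wlog ltab : a b ab gab / (a < b)%N => [W|].
  have : (a < b)%N || (b < a)%N by rewrite -neq_ltn; exact: ab.
  case/orP => h; first exact: (W a b).
  by apply: (W b a) => //; rewrite eq_sym.
exists (b - a)%N, (\col_i (Num.floor (b%:R * x i 0) - Num.floor (a%:R * x i 0))).
rewrite subn_gt0; split=> //; apply/mx_norm_lt => // i j.
rewrite !mxE natrB ?(ltnW ltab) // intrB ord1.
have -> : (b%:R - a%:R) * x i 0 - ((Num.floor (b%:R * x i 0))%:~R -
   (Num.floor (a%:R * x i 0))%:~R) = fr b i - fr a i by rewrite /fr; ring.
apply: le_lt_trans Ke.
move/ffunP/(_ i): gab; rewrite !ffunE => /(congr1 val) /= gab.
have /andP[fa0 _] := fr01 a i; have /andP[fb0 _] := fr01 b i.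
have K0 : 0 < K%:R :> R by rewrite ltr0n.
have /truncn_itv := mulr_ge0 (ltW K0) fa0.
have /truncn_itv := mulr_ge0 (ltW K0) fb0.
rewrite -gab => /andP[h1 h2] /andP[h3 h4].
rewrite -[leRHS]div1r ler_pdivlMr // -[X in _ * X](ger0_norm (ltW K0)) -normrM mulrBl ![_ * K%:R]mulrC.
rewrite ler_norml; move: h2 h4; rewrite -natr1; lra.
Qed.

(** Some [m] columns of [E] form an invertible [C]. By [dirichlet], a positive multiple of each
    column of [E] differs from an integral combination of columns of [C] by a group vector shorter
    than [e], hence by 0. So [E] is rational in the basis [C], and a common denominator makes a
    coordinate functional integral. *)
Lemma discrete_functional (R : realType) m s (E : 'M[R]_(m, s)) e :
  (0 < m)%N -> row_free E -> 0 < e ->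
  (forall r : 'cV[int]_s, `|E *m map_mx intr r| < e -> E *m map_mx intr r = 0) ->
  exists (u : 'rV[R]_m) (z : 'rV[int]_s), u != 0 /\ u *m E = map_mx intr z.
Proof.
case: m E => // m E _ fE e0 H.
have fE' : row_full E^T by rewrite /row_full mxrank_tr.
pose f := fullrankfun fE'; pose C := colsub f E.
have uC : C \in unitmx.
  rewrite -unitmx_tr; have -> : C^T = rowsub f E^T by apply/matrixP=> i j; rewrite !mxE.
  exact: fullrowsub_unit.
have colC (w : 'cV[int]_m.+1) :
    C *m map_mx intr w = E *m map_mx intr (\sum_i w i 0 *: delta_mx (f i) 0 : 'cV[int]_s).
  apply/colP=> i; rewrite !mxE.
  under [RHS]eq_bigr => j _ do rewrite mxE summxE rmorph_sum mulr_sumr.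
  rewrite exchange_big /=; apply: eq_bigr => j _.
  rewrite (bigD1 (f j)) //= big1 => [|k kj].
    by rewrite !mxE !eqxx mulr1 addr0.
  by rewrite !mxE (negbTE kj) mulr0 mulr0.
have [K K0 HK] := mulmx_bounded C.
have mult j : exists Nw : nat * 'cV[int]_m.+1, (0 < Nw.1)%N /\
    Nw.1%:R *: col j E = C *m map_mx intr Nw.2.
  (* The accuracy [e / K] leaves an error below [e] after multiplication by [C]. *)
  have [N [w [N0 Nw]]] := dirichlet (invmx C *m col j E) (divr_gt0 e0 K0).
  exists (N, w); split => //=.
  have E1 : C *m (N%:R *: (invmx C *m col j E) - map_mx intr w) =
      E *m map_mx intr (N%:Z *: delta_mx j 0 - \sum_i w i 0 *: delta_mx (f i) 0 : 'cV[int]_s).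
    rewrite mulmxBr -scalemxAr mulKVmx // colC map_mxB mulmxBr; congr (_ - _).
    by rewrite map_mxZ map_delta_mx -scalemxAr colE.
  have : C *m (N%:R *: (invmx C *m col j E) - map_mx intr w) = 0.
    rewrite E1; apply: H; rewrite -E1; apply: le_lt_trans (HK _ _) _.
    by rewrite mulrC -ltr_pdivlMr.
  by rewrite mulmxBr -scalemxAr mulKVmx // => /eqP; rewrite subr_eq0 => /eqP.
have [h Hh] := choice mult.
pose T := (\prod_j (h j).1)%N.
(* The first coordinate in the basis [C], scaled by the product [T] of all denominators; on column
   [j] the denominators of the other columns remain as a factor. *)
exists (T%:R *: row 0 (invmx C)),
  (\row_j ((\prod_(k | k != j) (h k).1)%N%:Z * (h j).2 0 0)); split.
  apply/eqP => /(congr1 (mulmx^~ C)); rewrite mul0mx -scalemxAl -row_mul mulVmx //.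
  move=> /matrixP/(_ 0 0); rewrite !mxE eqxx mulr1 => /eqP.
  rewrite pnatr_eq0 => /eqP T0.
  have : (0 < T)%N by apply: prodn_gt0 => j; case: (Hh j).
  by rewrite T0.
apply/rowP => j; have [N0 /(congr1 (mulmx (invmx C)))] := Hh j.
rewrite mulKmx // -scalemxAr => /matrixP/(_ 0 0) E2.
have {E2} E2 : (h j).1%:R * (row 0 (invmx C) *m E) 0 j = ((h j).2 0 0)%:~R.
  by move: E2; rewrite !mxE => <-; congr (_ * _); apply: eq_bigr => i _; rewrite !mxE.
rewrite -scalemxAl mxE /T (bigD1 j) //= natrM mulrC mulrA [_ * (h j).1%:R]mulrC.
rewrite E2 !mxE. by rewrite (rmorphM intr) mulrC.
Qed.

Lemma norm_trmx (R : realType) m n (x : 'M[R]_(m, n)) : `|x^T| = `|x|.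
Proof.
apply/eqP; rewrite eq_le; apply/andP; split; apply: mx_norm_le => // i j.
  by rewrite mxE mx_norm_ge.
by have := mx_norm_ge x^T j i; rewrite mxE.
Qed.

(* [v] is a limit of directions of ever shorter group vectors, whose integer
   multiples fill up the line it spans. *)
Lemma line_in_closure (R : realType) m s (E : 'M[R]_(m, s)) :
  (forall e, 0 < e -> exists r : 'cV[int]_s,
     `|E *m map_mx intr r| < e /\ E *m map_mx intr r != 0) ->
  exists v : 'cV[R]_m, v != 0 /\ forall t e, 0 < e ->
    exists r : 'cV[int]_s, `|E *m map_mx intr r - t *: v| < e.
Proof.
move=> H.
have k0 k : 0 < k.+1%:R^-1 :> R by rewrite invr_gt0 ltr0n.
have [r Hr] := choice (fun k => H _ (k0 k)).
pose g k := E *m map_mx intr (r k).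
have gn0 k : 0 < `|g k| by rewrite normr_gt0; case: (Hr k).
(* Transposed, because compactness of the unit sphere is obtained for row vectors. *)
pose u k := (`|g k|^-1 *: g k)^T.
pose A := [set x : 'rV[R]_m | `|x| = 1].
have uA k : A (u k).
  by rewrite /A /= norm_trmx normrZ normfV normr_id mulVf // gt_eqF.
have cA : compact A.
  apply: bounded_closed_compact.
    exists 1; split; first exact: num_real.
    by move=> M M1 x; rewrite /A /= => ->; exact: ltW.
  by apply: closed_comp (@closed_eq _ (1 : R)) => x _; exact: norm_continuous.
have [|w [Aw clw]] := cA (u @ \oo) _.
  by exists 0%N => // k _; exact: uA.
have near_w K e : 0 < e -> exists k, (K <= k)%N /\ `|u k - w| < e.
  move=> e0; have := clw [set u k | k in [set k | (K <= k)%N]] (ball w e).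
  case=> [||_ [[k /= Kk <-]]].
  - by exists K => // k /= Kk; exists k.
  - exact: nbhsx_ballx.
  by rewrite -ball_normE /= distrC; exists k.
exists w^T; split.
  by apply/eqP => /(congr1 Num.norm); rewrite norm_trmx Aw normr0 => /eqP; rewrite oner_eq0.
move=> t e e0.
have t0 : 0 < 2 * (`|t| + 1) by rewrite mulr_gt0 // ltr_wpDl.
(* Rounding [t / |g k|] down costs at most [|g k|], which an index beyond [2 / e] makes smaller than
   [e / 2]; the error in the direction, multiplied by [t], contributes the other half. *)
have [k [Kk uk]] := near_w (Num.truncn (2 / e)) _ (divr_gt0 e0 t0).
exists (Num.floor (t / `|g k|) *: r k).
rewrite map_mxZ -scalemxAr -/(g k).
set f := Num.floor _.
have -> : f%:~R *: g k - t *: w^T =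
   (f%:~R - t / `|g k|) *: g k + t *: (u k - w)^T.
  by rewrite linearB /= trmxK scalerBl scalerBr scalerA addrA subrK.
apply: le_lt_trans (ler_normD _ _) _.
rewrite !normrZ norm_trmx [e]splitr; apply: ler_ltD.
  have f1 : `|f%:~R - t / `|g k| | <= 1.
    rewrite distrC ger0_norm ?subr_ge0 ?floor_le // lerBlDl ltW //.
    by have := floorD1_gt (t / `|g k|); rewrite intrD.
  apply: (@le_trans _ _ (1 * `|g k|)); first by rewrite ler_wpM2r.
  rewrite mul1r; apply: ltW; apply: lt_le_trans (Hr k).1 _.
  rewrite -[leRHS]invrK lef_pV2 ?posrE ?ltr0n ?invr_gt0 ?divr_gt0 //.
  rewrite invf_div; apply: ltW; apply: lt_le_trans (truncnS_gt _) _.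
  by rewrite ler_nat.
apply: (@le_lt_trans _ _ ((`|t| + 1) * `|u k - w|)).
  by rewrite ler_wpM2r // lerDl.
move: uk; rewrite ltr_pdivlMr // => uk.
by rewrite ltr_pdivlMr // mulrC mulrA [_ * `|_|]mulrC.
Qed.

(** Splits off the line of [v]: [Q] is the quotient map, [S] a section of it and [b] the coordinate
    along [v]. They are read off from the rank factorisation of [v], in which the first column of
    the invertible [T] is proportional to [v]. *)
Lemma split_vector (F : fieldType) m (v : 'cV[F]_(1 + m)) : v != 0 ->
  exists (Q : 'M[F]_(m, 1 + m)) (S : 'M[F]_(1 + m, m)) (b : 'rV[F]_(1 + m)),
    Q *m S = 1%:M /\ v *m b + S *m Q = 1%:M.
Proof.
move=> v0; have rv : \rank v = 1%N by rewrite -mxrank_tr rank_rV trmx_eq0 v0.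
pose T := col_ebase v; pose c := row_ebase v.
have uT : T \in unitmx := col_ebase_unit v.
have uc : c \in unitmx := row_ebase_unit v.
have vE : v = lsubmx T *m c.
  rewrite -[LHS]mulmx_ebase rv; congr (_ *m _).
  rewrite -/T -[in LHS](hsubmxK T) (_ : pid_mx 1 = col_mx 1%:M 0).
    by rewrite mul_row_col mulmx1 mulmx0 addr0.
  by apply/matrixP => i j; rewrite !mxE /=; case: splitP => k Ek; rewrite !mxE Ek /= ?ord1.
pose V := invmx T; have TT : T *m V = 1%:M by rewrite mulmxV.
rewrite -(hsubmxK T) -(vsubmxK V) mul_row_col in TT.
have VT : V *m T = 1%:M by rewrite mulVmx.
rewrite -(hsubmxK T) -(vsubmxK V) mul_col_row in VT.
exists (dsubmx V), (rsubmx T), (invmx c *m usubmx V).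
rewrite {1}vE mulmxA mulmxK //; split => //.
by move: VT; rewrite scalar_mx_block => /eq_block_mx[].
Qed.

(* Kronecker's theorem, by induction on the dimension: a non-dense group is
   either discrete, or its closure contains a line that can be quotiented out. *)
Lemma kronecker (R : realType) m s (E : 'M[R]_(m, s)) :
  (forall (u : 'rV[R]_m) (z : 'rV[int]_s), u *m E = map_mx intr z -> u = 0) ->
  forall (y : 'cV[R]_m) e, 0 < e ->
    exists r : 'cV[int]_s, `|E *m map_mx intr r - y| < e.
Proof.
elim: m E => [|m IH] E H y e e0.
  exists 0; have -> : E *m map_mx intr (0 : 'cV[int]_s) - y = 0.
    by apply/matrixP => -[].
  by rewrite normr0.
have fE : row_free E.
  rewrite -kermx_eq0; apply/eqP/row_matrixP => i; rewrite row0.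
  apply: (H _ 0); rewrite map_mx0; apply/sub_kermxP; exact: row_sub.
have [d|d] := pselect (forall e, 0 < e -> exists r : 'cV[int]_s,
     `|E *m map_mx intr r| < e /\ E *m map_mx intr r != 0); last first.
  exfalso; apply: d => e' e'0; apply: contrapT => N.
  have [|u [z [u0 uz]]] := discrete_functional (ltn0Sn m) fE e'0.
    move=> r rlt; apply/eqP/negP => /negP r0; apply: N; exists r; split => //.
  by move: u0; rewrite (H _ _ uz) eqxx.
have [v [v0 Hv]] := line_in_closure d.
have [Q [S [b [QS bS]]]] := split_vector v0.
have [K K0 HK] := mulmx_bounded S.
have HQ (u : 'rV[R]_m) (z : 'rV[int]_s) : u *m (Q *m E) = map_mx intr z -> u = 0.
  rewrite mulmxA => /H uQ.
  by rewrite -[u]mulmx1 -QS mulmxA uQ mul0mx.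
(* [r1] approximates [y] modulo the line of [v], with accuracy [e / 2 / K] because lifting by [S]
   enlarges by at most [K]; [r2] then corrects the component along [v]. *)
have [r1 Hr1] := IH _ HQ (Q *m y) _ (divr_gt0 (divr_gt0 e0 (ltr0n _ 2)) K0).
have [r2 Hr2] := Hv ((b *m (y - E *m map_mx intr r1)) 0 0) _ (divr_gt0 e0 (ltr0n _ 2)).
exists (r1 + r2); rewrite map_mxD mulmxDr.
set t := (X in X *: v) in Hr2.
have E1 : y - E *m map_mx intr r1 = t *: v + S *m (Q *m y - Q *m E *m map_mx intr r1).
  rewrite -[LHS]mul1mx -bS mulmxDl -!mulmxA; congr (_ + _).
    by rewrite [b *m _]mx11_scalar mul_mx_scalar.
  by rewrite -mulmxBr.
have -> : E *m map_mx intr r1 + E *m map_mx intr r2 - y =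
   (E *m map_mx intr r2 - t *: v) + S *m (Q *m E *m map_mx intr r1 - Q *m y).
  have {}E1 : S *m (Q *m y - Q *m E *m map_mx intr r1) = y - E *m map_mx intr r1 - t *: v.
    by rewrite E1 [RHS]addrAC subrr add0r.
  rewrite -[Q *m E *m _ - _]opprB mulmxN E1 opprB addrA subrK opprB addrA.
  by rewrite [X in X - y]addrC.
apply: le_lt_trans (ler_normD _ _) _; rewrite [e]splitr; apply: ltrD => //.
by apply: le_lt_trans (HK _ _) _; rewrite mulrC -ltr_pdivlMr.
Qed.

(** * Conjugates and multiplicities *)

Lemma eqp_irreducible (F : fieldType) (p q : {poly F}) :
  p %= q -> irreducible_poly p -> irreducible_poly q.
Proof.
move=> pq [sp ip]; split => [|r sr rq]; first by rewrite -(eqp_size pq).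
by rewrite -(eqp_rtrans pq) ip // (eqp_dvdr _ pq).
Qed.

Lemma map_ratr_intr (C : numFieldType) (p : {poly int}) :
  map_poly ratr (map_poly intr p : {poly rat}) = map_poly (intr : int -> C) p.
Proof.
rewrite -map_poly_comp; apply: eq_map_poly => x /=; exact: ratr_int.
Qed.

(** An annihilating polynomial of least size is irreducible, and rescaling makes it monic. *)
Lemma minpoly_rat_exists (C : numFieldType) (z : C) (f : {poly rat}) :
  f != 0 -> root (map_poly ratr f) z ->
  exists p : {poly rat}, [/\ p \is monic, irreducible_poly p & root (map_poly ratr p) z].
Proof.
move=> f0 fz.
pose P k := `[< exists f : {poly rat}, [/\ f != 0, root (map_poly ratr f) z & size f = k] >].
have exP : exists k, P k by exists (size f); apply/asboolP; exists f.
case: (ex_minnP exP) => k /asboolP[g [g0 gz gk]] gmin.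
have lg : lead_coef g != 0 by rewrite lead_coef_eq0.
exists ((lead_coef g)^-1 *: g); split.
- by rewrite monicE lead_coefZ mulVf.
- apply: (@eqp_irreducible _ g); first by rewrite eqp_sym eqp_scale // invr_eq0.
  apply/(subfx_irreducibleP gz g0) => h hz h0.
  by rewrite gk; apply: gmin; apply/asboolP; exists h.
- by rewrite map_polyZ rootZ // fmorph_eq0 invr_eq0.
Qed.

(** If [p] did not divide [f], the two would be coprime, and coprimality persists over [C], where it
    excludes a common root. *)
Lemma minpoly_dvd (C : numFieldType) (z : C) (p f : {poly rat}) :
  irreducible_poly p -> root (map_poly ratr p) z -> root (map_poly ratr f) z ->
  p %| f.
Proof.
move=> ip pz fz; apply: contraT; rewrite -irreducible_poly_coprime //.
rewrite -(coprimep_map (ratr : {rmorphism rat -> C})) => /coprimep_root/(_ pz).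
by move: fz; rewrite rootE => ->.
Qed.

Lemma irreducible_separable (p : {poly rat}) :
  irreducible_poly p -> separable_poly p.
Proof.
move=> ip; rewrite unlock irreducible_poly_coprime //.
have p1 : (1 < size p)%N by case: ip.
have p'0 : p^`() != 0.
  (* This coefficient of the derivative is the degree of [p] times its leading coefficient. *)
  apply/eqP => /polyP/(_ (size p).-2); rewrite coef_deriv coef0.
  rewrite !prednK; last by rewrite -subn1 subn_gt0.
  move=> /eqP; rewrite mulrn_eq0 -leqn0 leqNgt -subn1 subn_gt0 p1 /=.
  by rewrite subn1 lead_coef_eq0 (negbTE (irredp_neq0 ip)).
apply/negP => /(dvdp_leq p'0); rewrite leqNgt; apply/negP/negPn.
exact: lt_size_deriv (irredp_neq0 ip).
Qed.

Lemma mup_root1 (C : numFieldType) (z : C) (p : {poly rat}) :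
  irreducible_poly p -> root (map_poly ratr p) z -> mup z (map_poly ratr p) = 1%N.
Proof.
move=> ip pz; have p0 : map_poly ratr p != 0 :> {poly C}.
  by rewrite map_poly_eq0 irredp_neq0.
apply/eqP; rewrite eqn_leq -XsubC_dvd // dvdp_XsubCl pz andbT.
rewrite -ltnS mup_ltn //; apply/negP => /dvdpP[q pE].
have : separable_poly (map_poly ratr p : {poly C}).
  by rewrite separable_map irreducible_separable.
rewrite pE expr2 mulrA separable_mul => /and3P[_ _].
by rewrite coprimep_XsubC rootM root_XsubC eqxx orbT.
Qed.

(** Strips factors [p] from [f] one at a time; the size decreases because [p] is not constant. *)
Lemma divisor_ind (F : fieldType) (p : {poly F}) (P : {poly F} -> Prop) :
  (1 < size p)%N -> (forall h, ~~ (p %| h) -> P h) ->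
  (forall g, g != 0 -> P g -> P (g * p)) -> forall f, f != 0 -> P f.
Proof.
move=> p1 Pn Pp f; have [k] := ubnP (size f); elim: k f => [|k IH] f.
  by rewrite ltn0.
rewrite ltnS => sf f0; have [/dvdpP[g fE]|/Pn//] := boolP (p %| f).
have /andP[g0 p0] : (g != 0) && (p != 0) by rewrite -negb_or -mulf_eq0 -fE.
rewrite fE; apply: (Pp _ g0); apply: IH (g0).
apply: leq_trans sf; rewrite fE (size_mul g0 p0).
move: p1; rewrite -size_poly_gt0 in g0.
by case: (size p) => // -[//|j] _; rewrite !addnS /= ltnS leq_addr.
Qed.

(** Each factor [p] of [f] contributes 1 at both roots, and a cofactor not divisible by [p] vanishes
    at neither. *)
Lemma mup_conjugate (C : numFieldType) (mu nu : C) (p f : {poly rat}) :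
  irreducible_poly p -> root (map_poly ratr p) mu -> root (map_poly ratr p) nu ->
  f != 0 -> mup mu (map_poly ratr f) = mup nu (map_poly ratr f).
Proof.
move=> ip pmu pnu; move: f.
have p0 : map_poly ratr p != 0 :> {poly C} by rewrite map_poly_eq0 irredp_neq0.
pose same (h : {poly rat}) := mup mu (map_poly ratr h) = mup nu (map_poly ratr h).
apply: (@divisor_ind _ p same ip.1) => [h nph|g g0 IH]; rewrite /same.
  rewrite (mupNroot (contraNN (minpoly_dvd ip pmu) nph)).
  by rewrite (mupNroot (contraNN (minpoly_dvd ip pnu) nph)).
have g0' : map_poly ratr g != 0 :> {poly C} by rewrite map_poly_eq0.
rewrite rmorphM /= (mupM _ g0' p0) (mupM _ g0' p0) IH.
by rewrite (mup_root1 ip pmu) (mup_root1 ip pnu).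
Qed.

(** Gauss's lemma: the primitive integer polynomial proportional to the rational minimal polynomial
    divides the monic [f] over the integers, so its leading coefficient is a unit; being positive,
    it is 1. *)
Lemma minpoly_int_exists (C : numFieldType) (z : C) :
  algebraic_integer z ->
  exists p : {poly int}, [/\ p \is monic, irreducible_poly (map_poly intr p : {poly rat}) &
    root (map_poly intr p) z].
Proof.
case=> f [fm fz]; rewrite -map_ratr_intr in fz.
have f0 : map_poly intr f != 0 :> {poly rat}.
  by rewrite map_poly_eq0_id0 ?monic_neq0 // (monicP fm) intr_eq0 oner_eq0.
have [p [pm ip pz]] := minpoly_rat_exists f0 fz.
have [q [a a0 pE]] := rat_poly_scale p.
have a0' : (a%:~R : rat)^-1 != 0 by rewrite invr_eq0 intr_eq0.
have q0 : q != 0.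
  by apply/eqP => q0; move: (irredp_neq0 ip); rewrite pE q0 rmorph0 scaler0 eqxx.
have qf : q %| f.
  rewrite -dvdp_rat_int; have := minpoly_dvd ip pz fz.
  by rewrite pE dvdpZl.
have [r fE] := dvdpP_int qf.
have lq : 0 < lead_coef (zprimitive q).
  by rewrite -sgz_gt0 sgz_lead_primitive q0.
have qm : zprimitive q \is monic.
  have : lead_coef (zprimitive q) \is a GRing.unit.
    by apply/unitrPr; exists (lead_coef r); rewrite -lead_coefM -fE (monicP fm).
  by rewrite monicE => /orP[//|/eqP lN]; move: lq; rewrite lN.
have qq : map_poly intr q = (zcontents q)%:~R *: map_poly intr (zprimitive q) :> {poly rat}.
  by rewrite {1}(zpolyEprim q) map_polyZ.
have c0 : (zcontents q)%:~R != 0 :> rat by rewrite intr_eq0 zcontents_eq0.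
exists (zprimitive q); split => //.
  apply: eqp_irreducible ip; rewrite pE qq scalerA.
  by rewrite eqp_scale // mulf_neq0.
by move: pz; rewrite pE qq scalerA map_polyZ rootZ ?map_ratr_intr // fmorph_eq0 mulf_neq0.
Qed.

Lemma char_poly_block (F : comNzRingType) n m (A : 'M[F]_n) (B : 'M[F]_(n, m)) (D : 'M[F]_m) :
  char_poly (block_mx A B 0 D) = char_poly A * char_poly D.
Proof.
rewrite /char_poly /char_poly_mx map_block_mx map_mx0.
by rewrite scalar_mx_block opp_block_mx add_block_mx subrr det_ublock.
Qed.

Lemma char_poly_similar (F : fieldType) n (P A B : 'M[F]_n) :
  P \in unitmx -> P *m A = B *m P -> char_poly A = char_poly B.
Proof.
move=> uP PA; rewrite /char_poly.
set Q := map_mx (@polyC F) P.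
have : Q *m char_poly_mx A = char_poly_mx B *m Q.
  by rewrite /char_poly_mx mulmxBr mulmxBl -!map_mxM PA scalar_mxC.
move/(congr1 determinant); rewrite !det_mulmx mulrC; apply: mulIf.
by rewrite det_map_mx polyC_eq0 -unitfE -unitmxE.
Qed.

(** * Necessity *)

(** By Bernoulli's inequality the powers of a number above 1 are unbounded. *)
Lemma expr_bounded_le1 (R : realType) (a b c : R) :
  0 < b -> (forall k, a ^+ k * b <= c) -> a <= 1.
Proof.
move=> b0 H; rewrite leNgt; apply/negP => a1.
have d0 : 0 < a - 1 by rewrite subr_gt0.
have bern k : 1 + k%:R * (a - 1) <= a ^+ k.
  elim: k => [|k IH]; first by rewrite mul0r addr0 expr0.
  rewrite exprS -natr1; apply: le_trans (ler_wpM2l (ltW (lt_trans ltr01 a1)) IH).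
  have : 0 <= k%:R * (a - 1) * (a - 1) by rewrite !mulr_ge0 // ltW.
  by lra.
pose k := (Num.truncn (c / b / (a - 1))).+1.
have : c / b / (a - 1) < k%:R by rewrite truncnS_gt.
rewrite ltr_pdivrMr // ltr_pdivrMr // => h.
have := le_trans (ler_wpM2r (ltW b0) (bern k)) (H k).
by apply/negP; rewrite -ltNge; move: h; lra.
Qed.

Lemma dense_approx (R : realType) m (S : set 'cV[R]_m) : dense S ->
  forall y e, 0 < e -> exists2 x, S x & `|x - y| < e.
Proof.
move=> dS y e e0; have := dS (ball y e).
case=> [||x [yx Sx]]; first by exists y; exact: ballxx.
  exact: ball_open.
by exists x => //; move: yx; rewrite -ball_normE /= distrC.
Qed.

Lemma window_ball (R : realType) m (W : set 'cV[R]_m) : window W ->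
  exists (c : 'cV[R]_m) e, 0 < e /\ forall y, `|y - c| < e -> W y.
Proof.
case=> _ cW [x]; rewrite -cW => /(_ setT filterT)[c [ic _]].
have /nbhs_ballP[e /= e0 He] := ic.
by exists c, e; split => // y yc; apply: He; rewrite -ball_normE /= distrC.
Qed.

Section Necessity.
Variables (R : realType) (n m : nat) (A : 'M[R]_n) (L : 'M[R]_(n + m)).
Variable W : set 'cV[R]_m.
Hypotheses (uL : L \in unitmx) (gL : generic_cps L) (wW : window W).
Hypothesis (AW : forall x, cps_set L W x -> cps_set L W (A *m x)).

Notation ir := (map_mx (intr : int -> R)).
Let B := usubmx L.
Let E := dsubmx L.

Let latP (r : 'cV[int]_(n + m)) : lattice L (L *m ir r). Proof. by exists r. Qed.

Let irI s (r : 'cV[int]_s) : ir r = 0 -> r = 0.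
Proof.
move=> r0; apply/matrixP => i j; move/matrixP/(_ i j): r0; rewrite !mxE => /eqP.
by rewrite intr_eq0 => /eqP.
Qed.

Let Lir0 (r : 'cV[int]_(n + m)) : L *m ir r = 0 -> r = 0.
Proof. by move=> /(congr1 (mulmx (invmx L))); rewrite mulKmx // mulmx0 => /irI. Qed.

Let Binj (r : 'cV[int]_(n + m)) : B *m ir r = 0 -> r = 0.
Proof.
move=> r0; apply: Lir0; rewrite -[RHS](mulmx0 1%N L) -[X in _ = L *m X](map_mx0 (intr : int -> R)).
case: gL => iB _ _; apply: iB; rewrite ?inE; try exact: latP.
by rewrite /pi_par -!mul_usub_mx -/B r0 map_mx0 mulmx0.
Qed.

Lemma perp_lattice_inj (r : 'cV[int]_(n + m)) : E *m ir r = 0 -> r = 0.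
Proof.
move=> r0; apply: Lir0; rewrite -[RHS](mulmx0 1%N L) -[X in _ = L *m X](map_mx0 (intr : int -> R)).
case: gL => _ iE _; apply: iE; rewrite ?inE; try exact: latP.
by rewrite /pi_perp -!mul_dsub_mx -/E r0 map_mx0 mulmx0.
Qed.

Let Edense y e : 0 < e -> exists r : 'cV[int]_(n + m), `|E *m ir r - y| < e.
Proof.
case: gL => _ _ dE e0; have [_ [_ [r _ <-] <-]] := dense_approx dE y e0.
by rewrite /pi_perp -mul_dsub_mx -/E => h; exists r.
Qed.

Let AWr (r : 'cV[int]_(n + m)) : W (E *m ir r) -> exists r' : 'cV[int]_(n + m), A *m (B *m ir r) = B *m ir r' /\ W (E *m ir r').
Proof.
move=> Wr; have [|_ [[r' _ <-] Wr'] <-] := AW (x := B *m ir r).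
  exists (L *m ir r); last by rewrite /pi_par -mul_usub_mx.
  by split; [exact: latP | rewrite /pi_perp -mul_dsub_mx].
by exists r'; move: Wr'; rewrite /pi_par /pi_perp -mul_usub_mx -mul_dsub_mx.
Qed.

(** Density puts some [E r2] near the centre of a ball inside the window, and a short [E r] keeps
    [E (r + r2)] in that ball. *)
Let small : exists2 e, 0 < e & forall r : 'cV[int]_(n + m), `|E *m ir r| < e ->
  exists r1 r2 : 'cV[int]_(n + m), [/\ r = r1 - r2, W (E *m ir r1) & W (E *m ir r2)].
Proof.
have [c [e [e0 He]]] := window_ball wW; exists (e / 2); first by rewrite divr_gt0.
move=> r rlt; have [r2 Hr2] := Edense c (divr_gt0 e0 (ltr0n _ 2)).
exists (r + r2), r2; rewrite addrK; split => //; apply: He; last first.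
  by apply: lt_trans Hr2 _; rewrite ltr_pdivrMr // ltr_pMr // ltr1n.
rewrite map_mxD mulmxDr -addrA; apply: le_lt_trans (ler_normD _ _) _.
by rewrite [e]splitr ltrD.
Qed.

(** Choose [r'] with [E r'] close to [E r / N]; then [r'] and the remainder are both short. Since
    [N] depends only on [e] and [rho], estimates for short vectors extend uniformly to bounded
    ones. *)
Let divide e rho : 0 < e -> 0 < rho -> exists N : nat, forall r : 'cV[int]_(n + m), `|E *m ir r| < rho ->
  exists r', `|E *m ir r'| < e /\ `|E *m ir (r - N%:Z *: r')| < e.
Proof.
move=> e0 rho0; pose N := (Num.truncn (2 * rho / e)).+1.
have N0 : 0 < N%:R :> R by rewrite ltr0n.
have rN : N%:R^-1 * rho < e / 2.
  have : 2 * rho / e < N%:R by rewrite truncnS_gt.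
  by rewrite ltr_pdivrMr // => h; rewrite mulrC ltr_pdivrMr // mulrAC ltr_pdivlMr // mulrC [e * _]mulrC.
have e'0 : 0 < e / (2 * N%:R) by rewrite divr_gt0 // mulr_gt0.
have eN : e / (2 * N%:R) <= e / 2.
  by rewrite ler_pM2l // lef_pV2 ?posrE ?mulr_gt0 // ler_peMr // ler1n.
exists N => r rlt; have [r' Hr'] := Edense (N%:R^-1 *: (E *m ir r)) e'0.
exists r'; split.
  rewrite -[X in `|X|](subrK (N%:R^-1 *: (E *m ir r))).
  apply: le_lt_trans (ler_normD _ _) _; rewrite [e]splitr ltrD //.
    exact: lt_le_trans Hr' eN.
  rewrite normrZ gtr0_norm ?invr_gt0 //; apply: lt_trans rN.
  by rewrite ltr_pM2l ?invr_gt0.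
have -> : E *m ir (r - N%:Z *: r') = - (N%:R *: (E *m ir r' - N%:R^-1 *: (E *m ir r))).
  rewrite scalerBr scalerA mulfV ?gt_eqF // scale1r opprB map_mxB mulmxBr.
  by rewrite map_mxZ -scalemxAr.
rewrite normrN normrZ gtr0_norm //; apply: (@lt_le_trans _ _ (N%:R * (e / (2 * N%:R)))).
  by rewrite ltr_pM2l.
have -> : N%:R * (e / (2 * N%:R)) = e / 2 by field; rewrite gt_eqF.
by rewrite ler_pdivrMr // ler_peMr ?ler1n // ltW.
Qed.

(** Short vectors are differences of window points, whose images under [A] again come from integral
    vectors; [divide] extends this to all integral vectors. The columns of [M] are the images of the
    basis vectors. *)
Let intmat : exists M : 'M[int]_(n + m), A *m B = B *m ir M.
Proof.
have [e e0 He] := small.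
have all (r : 'cV[int]_(n + m)) : exists r' : 'cV[int]_(n + m), A *m (B *m ir r) = B *m ir r'.
  have sm (r' : 'cV[int]_(n + m)) : `|E *m ir r'| < e -> exists r'' : 'cV[int]_(n + m), A *m (B *m ir r') = B *m ir r''.
    move=> /He[r1 [r2 [-> /AWr[s1 [h1 _]] /AWr[s2 [h2 _]]]]].
    by exists (s1 - s2); rewrite !map_mxB !mulmxBr h1 h2.
  have rho0 : 0 < `|E *m ir r| + 1 by rewrite ltr_wpDl.
  have [N /(_ r)[]] := divide e0 rho0; first by rewrite ltrDl.
  move=> r' [/sm[s1 h1] /sm[s2 h2]]; exists (s2 + N%:Z *: s1).
  rewrite -[r in LHS](subrK (N%:Z *: r')) [in LHS]map_mxD [in RHS]map_mxD !mulmxDr h2.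
  by rewrite !map_mxZ -!scalemxAr h1.
have [h Hh] := choice (fun j => all (delta_mx j 0)).
exists (\matrix_(i, j) h j i 0); apply/matrixP => i j.
have := congr1 (fun M : 'cV_n => M i 0) (Hh j).
rewrite mulmxA map_delta_mx -colE => h1.
transitivity ((col j (A *m B)) i 0); first by rewrite [RHS]mxE.
by rewrite h1 !mxE; apply: eq_bigr => k _; rewrite !mxE.
Qed.

Lemma dilation_block : exists (M : 'M[int]_(n + m)) (D : 'M[R]_m),
  L *m ir M = block_mx A 0 0 D *m L /\
  forall l, eigenvalue (cmx D) l -> `|l| <= 1.
Proof.
have [M AB] := intmat; exists M.
(* The integral vector supplied by [AWr] is [M] applied to the previous one, because [B] is
   injective on integral vectors. *)
have WM (r : 'cV[int]_(n + m)) k : W (E *m ir r) -> W (E *m ir (M ^+ k *m r)).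
  elim: k r => [|k IH] r Wr; first by rewrite expr0 mul1mx.
  rewrite exprS -mulmxE -mulmxA; have [r' [h1 h2]] := AWr (IH _ Wr).
  suff -> : M *m (M ^+ k *m r) = r' by [].
  apply/eqP; rewrite -subr_eq0; apply/eqP; apply: Binj.
  by rewrite map_mxB mulmxBr -h1 [in X in X - _]map_mxM !mulmxA AB subrr.
have [K HK] : exists K, forall y, W y -> `|y| <= K.
  case: wW => -[K [_ HK]] _ _; exists (K + 1) => y; apply: HK; by rewrite ltrDl.
(* Orbits of short vectors are differences of orbits inside the window; [divide] passes to all [r]
   with [|E r| < rho]. *)
have bnd rho : 0 < rho -> exists K', forall (r : 'cV[int]_(n + m)) k, `|E *m ir r| < rho ->
    `|E *m ir (M ^+ k *m r)| <= K'.
  move=> rho0; have [e e0 He] := small; have [N HN] := divide e0 rho0.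
  have sm (r : 'cV[int]_(n + m)) k : `|E *m ir r| < e -> `|E *m ir (M ^+ k *m r)| <= K + K.
    move=> /He[r1 [r2 [-> W1 W2]]]; rewrite mulmxBr map_mxB mulmxBr.
    by apply: le_trans (ler_normB _ _) _; apply: lerD; apply: HK; exact: WM.
  exists ((K + K) + N%:R * (K + K)) => r k /HN[r' [h1 h2]].
  rewrite -[X in M ^+ k *m X](subrK (N%:Z *: r')) mulmxDr map_mxD mulmxDr.
  apply: le_trans (ler_normD _ _) _; apply: lerD; first exact: sm.
  rewrite -scalemxAr map_mxZ -scalemxAr normrZ normr_nat.
  by apply: ler_wpM2l => //; exact: sm.
pose F := lsubmx (invmx L); pose G := rsubmx (invmx L).
have LE : L = col_mx B E by rewrite vsubmxK.
have IE : invmx L = row_mx F G by rewrite hsubmxK.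
have LI : L *m invmx L = 1%:M by rewrite mulmxV.
have IL : invmx L *m L = 1%:M by rewrite mulVmx.
rewrite IE {1}LE mul_col_row scalar_mx_block in LI; have [BF BG EF EG] := eq_block_mx LI.
rewrite IE LE mul_row_col in IL.
(* [E] vanishes on the columns of [F], so rounding [t] times such a column gives an integral [r]
   with [E r] bounded independently of [t]. A nonzero entry of [E M F] would make [E M r] grow
   linearly in [t]. *)
have EMF : E *m ir M *m F = 0.
  apply/matrixP => i j; rewrite [RHS]mxE; apply/eqP; rewrite -normr_le0 leNgt; apply/negP => x0.
  have [K1 K10 HK1] := mulmx_bounded E; have [K2 K20 HK2] := mulmx_bounded (E *m ir M).
  have [K' HK'] := bnd (K1 + 1) (addr_gt0 K10 ltr01).
  set x := `|_| in x0.
  have le t : t%:R * x <= K' + K2.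
    pose u := t%:R *: col j F; pose r := map_mx Num.floor u.
    have ru : `|ir r - u| <= 1.
      apply: mx_norm_le => // a b; rewrite !mxE; set z := t%:R * _.
      rewrite distrC ger0_norm ?subr_ge0 ?floor_le // lerBlDl ltW //.
      by have := floorD1_gt z; rewrite intrD.
    have Er : `|E *m ir r| < K1 + 1.
      have -> : E *m ir r = E *m (ir r - u).
        by rewrite mulmxBr -[E *m u]scalemxAr colE mulmxA EF mul0mx scaler0 subr0.
      apply: le_lt_trans (HK1 _ _) _; apply: (@le_lt_trans _ _ K1); last by rewrite ltrDl.
      by rewrite ler_piMr // ltW.
    have -> : t%:R * x = `|(E *m ir M *m u) i 0|.
      by rewrite -scalemxAr colE mulmxA -colE [in RHS]mxE [in RHS]mxE normrM normr_nat.
    apply: le_trans (mx_norm_ge _ _ _) _.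
    rewrite -[X in `|X|](subrK (E *m ir M *m ir r)) addrC -mulmxBr.
    apply: le_trans (ler_normD _ _) _; apply: lerD.
      by have := HK' r 1%N Er; rewrite expr1 map_mxM mulmxA.
    by apply: le_trans (HK2 _ _) _; rewrite -normrN opprB ler_piMr // ltW.
  pose t := (Num.truncn ((K' + K2) / x)).+1.
  have : (K' + K2) / x < t%:R by rewrite truncnS_gt.
  by rewrite ltr_pdivrMr // ltNge le.
pose D := E *m ir M *m G.
have EM : E *m ir M = D *m E.
  by rewrite -[LHS]mulmx1 -IL mulmxDr !mulmxA EMF mul0mx add0r.
exists D; split.
  by rewrite LE mul_col_mx mul_block_col !mul0mx addr0 add0r AB EM.
move=> l /eigenvalueP[y yD y0].
pose Ec := map_mx (real_complex R) E; pose Gc := map_mx (real_complex R) G.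
have EGc : Ec *m Gc = 1%:M by rewrite -map_mxM EG map_mx1.
(* [E] has the right inverse [G], so [y E] has a nonzero coordinate [j]. The bounded orbit of the
   basis vector [j] then bounds [|l| ^ k] times that coordinate. *)
have : y *m Ec != 0.
  by apply: contraNneq y0 => h; rewrite -[y]mulmx1 -EGc mulmxA h mul0mx.
case/rV0Pn => j yj0.
have EMk k : E *m ir (M ^+ k) = D ^+ k *m E.
  elim: k => [|k IH]; first by rewrite !expr0 mul1mx map_mx1 mulmx1.
  by rewrite exprS -mulmxE map_mxM mulmxA EM -mulmxA IH exprS -mulmxE mulmxA.
have yDk k : y *m map_mx (real_complex R) (D ^+ k) = l ^+ k *: y.
  elim: k => [|k IH]; first by rewrite !expr0 scale1r map_mx1 mulmx1.
  by rewrite !exprS -mulmxE map_mxM mulmxA yD -scalemxAl IH scalerA.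
have rho0 : 0 < `|E *m ir (delta_mx j 0 : 'cV[int]_(n + m))| + 1 by rewrite ltr_wpDl.
have [K' HK'] := bnd _ rho0.
have normE (z : R[i]) : `|z| = (ComplexField.Normc.normc z)%:C%C by [].
rewrite normE -[1]/(1%:C)%C lecR.
apply: (@expr_bounded_le1 R (ComplexField.Normc.normc l) (ComplexField.Normc.normc ((y *m Ec) 0 j))
   (\sum_i ComplexField.Normc.normc (y 0 i) * K')).
  by move: yj0; rewrite -normr_gt0 normE -[0]/(0%:C)%C ltcR.
move=> k; rewrite -lecR rmorphM rmorphXn /= -!normE -normrX -normrM.
have -> : l ^+ k * (y *m Ec) 0 j = (y *m map_mx (real_complex R) (E *m ir (M ^+ k *m (delta_mx j 0 : 'cV[int]_(n + m))))) 0 0.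
  have -> : E *m ir (M ^+ k *m (delta_mx j 0 : 'cV[int]_(n + m))) = D ^+ k *m (E *m delta_mx j 0).
    by rewrite map_mxM map_delta_mx !mulmxA EMk.
  rewrite map_mxM mulmxA yDk -scalemxAl [RHS]mxE; congr (_ * _).
  by rewrite map_mxM map_delta_mx mulmxA -colE [RHS]mxE.
rewrite mxE rmorph_sum; apply: le_trans (ler_norm_sum _ _ _) _; apply: ler_sum => i _.
rewrite normrM rmorphM /= -normE ler_wpM2l // mxE normE lecR.
rewrite /ComplexField.Normc.normc /= expr0n addr0 sqrtr_sqr.
apply: le_trans (mx_norm_ge _ _ _) _; apply: HK'; by rewrite ltrDl.
Qed.

End Necessity.

Lemma rat_vector_scale s (r : 'cV[rat]_s) :
  exists (N : int) (z : 'cV[int]_s), N != 0 /\ N%:~R *: r = map_mx intr z.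
Proof.
exists (\prod_i denq (r i 0)), (\col_i (numq (r i 0) * \prod_(j | j != i) denq (r j 0))).
split; first by apply/prodf_neq0 => i _; exact: denq_neq0.
apply/colP => i; rewrite !mxE (bigD1 i) //= !rmorphM /=.
by rewrite numqE mulrC mulrA.
Qed.

Lemma horner_mx_intertwine (F : fieldType) s m (E : 'M[F]_(m.+1, s.+1)) M D p :
  E *m M = D *m E -> E *m horner_mx M p = horner_mx D p *m E.
Proof.
move=> EM; elim/poly_ind: p => [|p c IH]; first by rewrite !rmorph0 mul0mx mulmx0.
rewrite !rmorphD !rmorphM /= !horner_mx_X !horner_mx_C -!mulmxE.
by rewrite mulmxDr mulmxDl mulmxA IH -!mulmxA EM mul_mx_scalar mul_scalar_mx.
Qed.

Lemma horner_mx_eigen (F : fieldType) s (y : 'rV[F]_s.+1) M l p :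
  y *m M = l *: y -> y *m horner_mx M p = p.[l] *: y.
Proof.
move=> yM; elim/poly_ind: p => [|p c IH].
  by rewrite rmorph0 mulmx0 horner0 scale0r.
rewrite rmorphD rmorphM /= horner_mx_X horner_mx_C -mulmxE hornerMXaddC.
by rewrite mulmxDr mulmxA IH -scalemxAl yM scalerA scalerDl mul_mx_scalar.
Qed.

(** As [mu] is an eigenvalue of [M] and a root of [p], the rational matrix [p(M)] is singular and
    kills a rational vector [r]. From [E p(M) = p(D) E], with [p(D)] invertible by Bezout and
    Cayley-Hamilton, [E r = 0] follows; denominators are then cleared. *)
Lemma rational_kernel_S (C : numFieldType) s m (M : 'M[rat]_s.+1) (E : 'M[C]_(m.+1, s.+1))
    (D : 'M[C]_m.+1) (p : {poly rat}) (mu : C) :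
  E *m map_mx ratr M = D *m E ->
  coprimep (map_poly ratr p) (char_poly D) ->
  root (map_poly ratr p) mu -> root (map_poly ratr (char_poly M)) mu ->
  exists r : 'cV[int]_s.+1, r != 0 /\ E *m map_mx intr r = 0.
Proof.
move=> EM cpD pmu; rewrite map_char_poly -eigenvalue_root_char => /eigenvalueP[y yM y0].
have pM : horner_mx M p \notin unitmx.
  rewrite -(map_unitmx (ratr : {rmorphism rat -> C})) map_horner_mx.
  apply: contra y0 => u; have := horner_mx_eigen (map_poly ratr p) yM.
  rewrite (rootP pmu) scale0r => /(congr1 (mulmx^~ (invmx (horner_mx (map_mx ratr M) (map_poly ratr p))))).
  by rewrite mulmxK // mul0mx => ->.
have [r r0 pMr] : exists2 r : 'cV[rat]_s.+1, r != 0 & horner_mx M p *m r = 0.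
  move: pM; rewrite -unitmx_tr -row_free_unit -kermx_eq0 => /rowV0Pn[v /sub_kermxP vM v0].
  exists v^T; first by rewrite trmx_eq0.
  by rewrite -[horner_mx M p]trmxK -trmx_mul vM trmx0.
have pD : horner_mx D (map_poly ratr p) \in unitmx.
  have /Bezout_eq1_coprimepP[[u v] /= uv] := cpD.
  have := congr1 (horner_mx D) uv.
  rewrite rmorphD !rmorphM /= Cayley_Hamilton mulr0 addr0 rmorph1 -mulmxE => /mulmx1_unit.
  by case.
have Er : E *m map_mx ratr r = 0.
  have := horner_mx_intertwine (map_poly ratr p) EM.
  move=> /(congr1 (mulmx^~ (map_mx ratr r))); rewrite -mulmxA -map_horner_mx -map_mxM pMr.
  rewrite map_mx0 mulmx0 -mulmxA => /(congr1 (mulmx (invmx (horner_mx D (map_poly ratr p))))).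
  by rewrite mulmx0 mulKmx.
have [N [z [N0 Nz]]] := rat_vector_scale r.
exists z; split.
  apply: contra_neq r0 => z0; move: Nz; rewrite z0 map_mx0 => /eqP.
  by rewrite scaler_eq0 intr_eq0 (negbTE N0) => /eqP.
have -> : map_mx intr z = map_mx ratr (N%:~R *: r) :> 'cV[C]_s.+1.
  by rewrite Nz -map_mx_comp; apply/matrixP => i j; rewrite !mxE /= ratr_int.
by rewrite map_mxZ -scalemxAr Er scaler0.
Qed.

Lemma rational_kernel (C : numFieldType) s m (M : 'M[rat]_s) (E : 'M[C]_(m, s))
    (D : 'M[C]_m) (p : {poly rat}) (mu : C) :
  (0 < s)%N -> (0 < m)%N -> E *m map_mx ratr M = D *m E ->
  coprimep (map_poly ratr p) (char_poly D) ->
  root (map_poly ratr p) mu -> root (map_poly ratr (char_poly M)) mu ->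
  exists r : 'cV[int]_s, r != 0 /\ E *m map_mx intr r = 0.
Proof.
case: s m M E D => [//|s] [//|m] M E D _ _; exact: rational_kernel_S.
Qed.

Lemma dilation_spectrum (R : realType) n m (A : 'M[R]_n) (L : 'M[R]_(n + m)) W :
  (0 < n)%N -> (0 < m)%N ->
  L \in unitmx -> generic_cps L -> window W ->
  (forall x, cps_set L W x -> cps_set L W (A *m x)) ->
  (forall l : R[i], eigenvalue (cmx A) l -> algebraic_integer l) /\
  (forall mu : R[i], 1 < `|mu| ->
      (exists l : R[i], eigenvalue (cmx A) l /\ alg_conjugate l mu) ->
      [/\ eigenvalue (cmx A) mu,
          forall nu : R[i], alg_conjugate mu nu ->
            (alg_mult (cmx A) nu <= alg_mult (cmx A) mu)%N &
          exists nu : R[i], alg_conjugate mu nu /\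
            (alg_mult (cmx A) nu < alg_mult (cmx A) mu)%N]).
Proof.
move=> n0 m0 uL gL wW AW; have [M [D [LM Dle]]] := dilation_block uL gL wW AW.
pose chi : {poly rat} := map_poly intr (char_poly M).
have chiE : map_poly ratr chi = char_poly (cmx A) * char_poly (cmx D).
  rewrite map_ratr_intr -!(map_char_poly (real_complex R)) -rmorphM /= -(char_poly_block A 0 D).
  rewrite -(char_poly_similar uL LM) -map_char_poly -map_poly_comp.
  by apply: eq_map_poly => x /=; rewrite rmorph_int.
have chi0 : chi != 0.
  by rewrite map_poly_eq0_id0 ?monic_neq0 ?char_poly_monic // (monicP (char_poly_monic _)) intr_eq0 oner_eq0.
have cA0 : char_poly (cmx A) != 0 by rewrite monic_neq0 ?char_poly_monic.
have cD0 : char_poly (cmx D) != 0 by rewrite monic_neq0 ?char_poly_monic.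
have rootA l : eigenvalue (cmx A) l -> root (map_poly ratr chi) l.
  by rewrite eigenvalue_root_char chiE rootM => ->.
split => [l /rootA lA|mu mu1 [l [lA [p [pm ip pl pmu]]]]].
  by exists (char_poly M); rewrite char_poly_monic -map_ratr_intr.
have Dmu : ~~ root (char_poly (cmx D)) mu.
  rewrite -eigenvalue_root_char; apply/negP => /Dle /(lt_le_trans mu1).
  by rewrite ltxx.
have chimu : root (map_poly ratr chi) mu.
  have /dvdpP[q ->] := minpoly_dvd ip pl (rootA _ lA).
  by rewrite rmorphM rootM pmu orbT.
have mumult : mup mu (map_poly ratr chi) = alg_mult (cmx A) mu by rewrite chiE mupMl.
(* All conjugates of [mu] have the same multiplicity in the integer matrix [M], and [D] contributes
   nothing at [mu] itself. *)
have conjmult nu : alg_conjugate mu nu ->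
    alg_mult (cmx A) mu = (alg_mult (cmx A) nu + alg_mult (cmx D) nu)%N.
  case=> q [_ iq qmu qnu]; rewrite -mumult (mup_conjugate iq qmu qnu chi0).
  by rewrite chiE mupM.
split.
- rewrite eigenvalue_root_char; move: chimu; rewrite chiE rootM => /orP[//|].
  by rewrite (negbTE Dmu).
- by move=> nu /conjmult ->; exact: leq_addr.
(* Without a strict inequality no conjugate of [mu] is an eigenvalue of [D], so [p] is coprime to
   its characteristic polynomial. *)
apply: contrapT => N.
have cpD : coprimep (map_poly ratr p) (char_poly (cmx D)).
  apply: Pdiv.ClosedField.root_coprimep => nu pnu; rewrite -rootE; apply/negP => Dnu.
  have cnu : alg_conjugate mu nu by exists p.
  apply: N; exists nu; split => //; rewrite (conjmult nu) // -[ltnLHS]addn0 ltn_add2l.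
  by rewrite /alg_mult -XsubC_dvd // dvdp_XsubCl.
have EM : dsubmx L *m map_mx intr M = D *m dsubmx L.
  have := congr1 dsubmx LM; rewrite -mul_dsub_mx => ->.
  by rewrite -[L in LHS]vsubmxK mul_block_col col_mxKd mul0mx add0r.
have cEM : map_mx (real_complex R) (dsubmx L) *m map_mx ratr (map_mx intr M : 'M[rat]_(n + m)) =
    cmx D *m map_mx (real_complex R) (dsubmx L).
  rewrite -map_mxM -EM map_mxM; congr (_ *m _); rewrite -!map_mx_comp.
  by apply/matrixP => i j; rewrite !mxE /= ratr_int rmorph_int.
have s0 : (0 < n + m)%N by rewrite addn_gt0 n0.
have chiM : root (map_poly ratr (char_poly (map_mx intr M : 'M[rat]_(n + m)))) mu.
  by rewrite -(map_char_poly (intr : {rmorphism int -> rat})).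
have [r [r0 Er]] := rational_kernel s0 m0 cEM cpD pmu chiM.
move: r0; rewrite (perp_lattice_inj uL gL (r := r)) ?eqxx //.
have : map_mx (real_complex R) (dsubmx L *m map_mx intr r) = 0.
  rewrite map_mxM -[RHS]Er -map_mx_comp; congr (_ *m _).
  by apply/matrixP => i j; rewrite !mxE /= rmorph_int.
by move/eqP; rewrite map_mx_eq0 => /eqP.
Qed.

(** * Integer matrices with prescribed spectrum *)

(* If [z] had a zero eigencoordinate, the rational matrix with rows [z N^i]
   would be singular over [C], hence over the rationals, giving a polynomial of
   degree less than [d] that annihilates [z]. *)
Lemma krylov_eigen_neq0 (C : numFieldType) d (N : 'M[rat]_d) (Y : 'M[C]_d)
    (a : 'rV[C]_d) (z : 'rV[rat]_d) :
  Y \in unitmx -> map_mx ratr N *m Y = Y *m diag_mx a ->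
  (forall (h : {poly rat}) l, (size h <= d)%N -> h != 0 -> ~~ root (map_poly ratr h) (a 0 l)) ->
  z != 0 -> forall l, (map_mx ratr z *m Y) 0 l != 0.
Proof.
move=> uY NY hroot z0 l; apply/negP => /eqP zl.
pose K : 'M[rat]_d := \matrix_i (z *m N ^+ i).
have zNY i : map_mx ratr (z *m N ^+ i) *m Y = (map_mx ratr z *m Y) *m diag_mx a ^+ i.
  elim: i => [|i IH]; first by rewrite !expr0 !mulmx1.
  rewrite !exprSr -!mulmxE mulmxA map_mxM -mulmxA NY mulmxA IH.
  by rewrite -!mulmxA.
have diagX i : diag_mx a ^+ i = diag_mx (\row_j a 0 j ^+ i).
  elim: i => [|i IH]; last first.
    rewrite exprS IH -mulmxE mulmx_diag; congr diag_mx; apply/rowP => j.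
    by rewrite !mxE exprS.
  rewrite expr0; apply/matrixP => j k; rewrite !mxE expr0.
  by case: (_ == _).
have KY i j : (map_mx ratr K *m Y) i j = a 0 j ^+ i * (map_mx ratr z *m Y) 0 j.
  have -> : (map_mx ratr K *m Y) i j = (map_mx ratr (z *m N ^+ i) *m Y) 0 j.
    by rewrite !mxE; apply: eq_bigr => k _; rewrite !mxE.
  by rewrite zNY diagX mul_mx_diag mxE mulrC [X in X * _]mxE.
have : K \notin unitmx.
  rewrite -(map_unitmx (ratr : {rmorphism rat -> C})); apply/negP => uK.
  have : map_mx ratr K *m Y \in unitmx by rewrite unitmx_mul uK.
  rewrite -unitmx_tr unitmxE (expand_det_row _ l) big1 ?unitr0 // => k _.
  by rewrite mxE KY zl mulr0 mul0r.
rewrite -row_free_unit -kermx_eq0 => /rowV0Pn[c /sub_kermxP cK c0].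
(* [c] is a linear relation between the rows of [K], and [h] has the same coefficients; the default
   0 of [insub] is never reached for [i < d]. The relation says that [h] at [a 0 j], which is
   nonzero, times coordinate [j] of [z Y] vanishes. *)
pose h := \poly_(i < d) (if insub i is Some j then c 0 j else 0 : rat).
have hc (i : 'I_d) : h`_i = c 0 i by rewrite coef_poly ltn_ord valK.
have h0 : h != 0.
  by case/rV0Pn: c0 => i ci; apply: contra_neq ci => h0; rewrite -hc h0 coef0.
have hE x : (map_poly ratr h).[x] = \sum_(i < d) ratr (c 0 i) * x ^+ i :> C.
  rewrite (@horner_coef_wide _ d); last by rewrite size_map_poly size_poly.
  by apply: eq_bigr => i _; rewrite coef_map /= hc.
have zY0 : map_mx ratr z *m Y = 0.
  apply/rowP => j; rewrite [RHS]mxE; apply/eqP.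
  have := hroot h j (size_poly _ _) h0; rewrite rootE hE => hj.
  have := congr1 (fun x => (map_mx ratr x *m Y) 0 j) cK.
  rewrite map_mx0 mul0mx [RHS]mxE map_mxM -mulmxA mxE.
  under eq_bigr => i _ do rewrite KY mxE mulrA.
  by rewrite -mulr_suml => /eqP; rewrite mulf_eq0 (negbTE hj).
move/(congr1 (mulmx^~ (invmx Y))): zY0; rewrite mulmxK // mul0mx => /eqP.
by rewrite map_mx_eq0 (negbTE z0).
Qed.

(* The last two clauses express Galois symmetry: the eigenvalues at which a
   nonzero rational vector has a nonzero eigencoordinate contain a full
   conjugacy class. *)
Definition int_spectral (C : numFieldType) (ps : seq {poly int}) s
    (M : 'M[int]_s) (d : 'rV[C]_s) (Q U : 'M[C]_s) : Prop :=
  [/\ Q *m U = 1%:M, map_mx intr M *m U = U *m diag_mx d,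
    forall nu, #|[pred l | d 0 l == nu]| = count (fun p => root (map_poly intr p) nu) ps,
    forall r : 'cV[rat]_s, r != 0 -> exists2 p, p \in ps &
      forall nu, root (map_poly intr p) nu -> exists l, d 0 l = nu /\ (Q *m map_mx ratr r) l 0 != 0 &
    forall z : 'rV[rat]_s, z != 0 -> exists2 p, p \in ps &
      forall nu, root (map_poly intr p) nu -> exists l, d 0 l = nu /\ (map_mx ratr z *m U) 0 l != 0].

(** The roots are simple by separability, so their Vandermonde matrix is invertible and diagonalises
    the companion matrix. No nonzero rational polynomial of smaller degree vanishes at a root, so
    [krylov_eigen_neq0] makes every eigencoordinate of a nonzero rational vector nonzero. *)
Lemma companion_spectral (C : numClosedFieldType) (p : {poly int}) :
  p \is monic -> irreducible_poly (map_poly intr p : {poly rat}) ->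
  exists (d : 'rV[C]_(size p).-1) Q U, int_spectral [:: p] (companionmx p) d Q U.
Proof.
move=> pm ip; set s := (size p).-1.
have lp1 : lead_coef p = 1 by apply/monicP.
pose pC : {poly C} := map_poly intr p.
have pCm : pC \is monic by rewrite monic_map.
have spC : size pC = size p by rewrite size_map_poly_id0 // lp1 rmorph1 oner_neq0.
have sp : size p = s.+1 by rewrite prednK // size_poly_gt0 monic_neq0.
have [rs] := closed_field_poly_normal pC; rewrite (monicP pCm) scale1r => pCE.
have urs : uniq rs.
  rewrite -separable_prod_XsubC -pCE /pC -map_ratr_intr separable_map.
  exact: irreducible_separable.
have srs : size rs == s by rewrite -eqSS -sp -spC pCE size_prod_XsubC.
pose d : 'rV[C]_s := \row_i nth 0 rs i.
have droot l : root pC (d 0 l).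
  by rewrite pCE root_prod_XsubC mxE mem_nth // (eqP srs).
pose U := Vandermonde s d.
have uU : U \in unitmx.
  rewrite unitmxE det_Vandermonde unitfE; apply/prodf_neq0 => i _.
  apply/prodf_neq0 => j ij; rewrite subr_eq0 !mxE nth_uniq ?(eqP srs) //.
  by rewrite gtn_eqF.
(* Column [j] of [U] lists the powers of a root; the companion matrix shifts them, and its last row
   expresses the power [s] through the lower ones. *)
have MU : map_mx intr (companionmx p) *m U = U *m diag_mx d.
  apply/matrixP => i j; rewrite mul_mx_diag mxE [in RHS]mxE [in RHS]mxE -exprSr.
  have s0 : (0 < s)%N := leq_ltn_trans (leq0n i) (ltn_ord i).
  have [iE|iN] := eqVneq (i : nat) s.-1; last first.
    have is1 : (i.+1 < s)%N.
      by rewrite -[s]prednK // ltnS ltn_neqAle iN /= -ltnS prednK.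
    rewrite (bigD1 (Ordinal is1)) //= big1 => [|k ki].
      by rewrite !mxE /= (negbTE iN) eqxx rmorph1 mul1r addr0.
    rewrite !mxE (negbTE iN) [_ == _]eq_sym.
    by rewrite -val_eqE /= in ki; rewrite (negbTE ki) rmorph0 mul0r.
  have h : pC.[d 0 j] == 0 by rewrite -rootE.
  rewrite horner_coef spC sp big_ord_recr /= in h.
  have pCs : pC`_s = 1 by rewrite coef_map /= -lead_coefE lp1.
  rewrite pCs mul1r addrC addr_eq0 in h.
  rewrite iE prednK // (eqP h).
  rewrite -sumrN; apply: eq_bigr => k _.
  by rewrite !mxE iE eqxx rmorphN mulNr coef_map.
have hroot (h : {poly rat}) l : (size h <= s)%N -> h != 0 -> ~~ root (map_poly ratr h) (d 0 l).
  move=> hs h0; apply/negP => hd; have := droot l; rewrite /pC -map_ratr_intr => pd.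
  have := dvdp_leq h0 (minpoly_dvd ip pd hd).
  by rewrite size_map_poly_id0 ?lp1 ?rmorph1 ?oner_neq0 // sp leqNgt ltnS hs.
have Mrat : map_mx ratr (map_mx intr (companionmx p) : 'M[rat]_s) = map_mx intr (companionmx p) :> 'M[C]_s.
  by rewrite -map_mx_comp; apply/matrixP => i j; rewrite !mxE /= ratr_int.
exists d, (invmx U), U; split => //.
- by rewrite mulVmx.
- move=> nu /=; rewrite addn0 -/pC; have [pnu|pnu] := boolP (root pC nu).
    have nurs : (index nu rs < s)%N by rewrite -(eqP srs) index_mem -root_prod_XsubC -pCE.
    rewrite (eq_card (B := pred1 (Ordinal nurs))) ?card1 // => l.
    rewrite !inE mxE -val_eqE /=; apply/eqP/eqP => [<-|->].
      by rewrite index_uniq // (eqP srs).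
    by rewrite nth_index // -index_mem (eqP srs).
  apply: eq_card0 => l; rewrite inE; apply: contraNF pnu => /eqP <-; exact: droot.
- move=> r r0; exists p; rewrite ?mem_head // => nu nuroot.
  have nurs : (index nu rs < s)%N by rewrite -(eqP srs) index_mem -root_prod_XsubC -pCE.
  exists (Ordinal nurs); split.
    by rewrite mxE nth_index // -index_mem (eqP srs).
  (* Column vectors are handled by transposition: the transposed companion matrix is diagonalised by
     the transpose of [invmx U]. *)
  have := @krylov_eigen_neq0 C s (map_mx intr (companionmx p))^T (invmx U)^T d r^T _ _ hroot.
  rewrite unitmx_tr unitmx_inv uU trmx_eq0 -!map_trmx Mrat => /(_ isT) H.
  have : (map_mx intr (companionmx p))^T *m (invmx U)^T = (invmx U)^T *m diag_mx d.
    rewrite -trmx_mul -[diag_mx d]tr_diag_mx -trmx_mul; congr trmx.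
    by rewrite -[LHS]mulmx1 -(mulmxV uU) mulmxA -[_ *m _ *m U]mulmxA MU !mulmxA mulVmx // mul1mx.
  by move=> /H /(_ r0 (Ordinal nurs)); rewrite -trmx_mul mxE.
- move=> r r0; exists p; rewrite ?mem_head // => nu nuroot.
  have nurs : (index nu rs < s)%N by rewrite -(eqP srs) index_mem -root_prod_XsubC -pCE.
  exists (Ordinal nurs); split.
    by rewrite mxE nth_index // -index_mem (eqP srs).
  by apply: (krylov_eigen_neq0 (N := map_mx intr (companionmx p)) uU _ hroot r0); rewrite Mrat.
Qed.

Lemma int_spectral_nil (C : numClosedFieldType) :
  @int_spectral C [::] 0 0 0 0 0.
Proof.
split.
- by apply/matrixP => -[].
- by apply/matrixP => -[].
- by move=> nu; apply: eq_card0 => -[].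
- by move=> r; rewrite (_ : r = 0) ?eqxx //; apply/matrixP => -[].
- by move=> r; rewrite (_ : r = 0) ?eqxx //; apply/matrixP => i -[].
Qed.

(** A nonzero vector has a nonzero block, and the polynomial found for that block serves the direct
    sum. *)
Lemma int_spectral_cat (C : numClosedFieldType) ps1 ps2 s1 s2
   (M1 : 'M[int]_s1) (d1 : 'rV[C]_s1) Q1 U1 (M2 : 'M[int]_s2) (d2 : 'rV[C]_s2) Q2 U2 :
  int_spectral ps1 M1 d1 Q1 U1 -> int_spectral ps2 M2 d2 Q2 U2 ->
  int_spectral (ps1 ++ ps2) (block_mx M1 0 0 M2) (row_mx d1 d2)
    (block_mx Q1 0 0 Q2) (block_mx U1 0 0 U2).
Proof.
move=> [QU1 MU1 c1 r1 z1] [QU2 MU2 c2 r2 z2]; split.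
- by rewrite mulmx_block !mulmx0 !mul0mx !addr0 add0r QU1 QU2 -scalar_mx_block.
- rewrite map_block_mx !map_mx0 diag_mx_row !mulmx_block !mulmx0 !mul0mx !addr0 !add0r.
  by rewrite MU1 MU2.
- move=> nu; rewrite count_cat -c1 -c2 -!sum1_card big_split_ord /=.
  by congr (_ + _)%N; apply: eq_bigl => l; rewrite !inE ?row_mxEl ?row_mxEr.
- move=> r r0; rewrite -[r]vsubmxK in r0 *.
  have [u0|u0] := eqVneq (usubmx r) 0; last first.
    have [p pp Hp] := r1 _ u0; exists p; first by rewrite mem_cat pp.
    move=> nu /Hp[l [dl rl]]; exists (lshift _ l); rewrite row_mxEl; split => //.
    by rewrite map_col_mx mul_block_col col_mxEu !mul0mx addr0.
  have u1 : dsubmx r != 0 by apply: contra_neq r0 => ->; rewrite u0 col_mx0.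
  have [p pp Hp] := r2 _ u1; exists p; first by rewrite mem_cat pp orbT.
  move=> nu /Hp[l [dl rl]]; exists (rshift _ l); rewrite row_mxEr; split => //.
  by rewrite map_col_mx mul_block_col col_mxEd !mul0mx add0r.
- move=> r r0; rewrite -[r]hsubmxK in r0 *.
  have [u0|u0] := eqVneq (lsubmx r) 0; last first.
    have [p pp Hp] := z1 _ u0; exists p; first by rewrite mem_cat pp.
    move=> nu /Hp[l [dl rl]]; exists (lshift _ l); rewrite row_mxEl; split => //.
    by rewrite map_row_mx mul_row_block row_mxEl !mulmx0 addr0.
  have u1 : rsubmx r != 0 by apply: contra_neq r0 => ->; rewrite u0 row_mx0.
  have [p pp Hp] := z2 _ u1; exists p; first by rewrite mem_cat pp orbT.
  move=> nu /Hp[l [dl rl]]; exists (rshift _ l); rewrite row_mxEr; split => //.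
  by rewrite map_row_mx mul_row_block row_mxEr !mulmx0 add0r.
Qed.

Lemma int_spectral_exists (C : numClosedFieldType) (ps : seq {poly int}) :
  (forall p, p \in ps -> p \is monic /\ irreducible_poly (map_poly intr p : {poly rat})) ->
  exists s (M : 'M[int]_s) (d : 'rV[C]_s) Q U, int_spectral ps M d Q U.
Proof.
elim: ps => [|p ps IH] H.
  by exists 0%N, 0, 0, 0, 0; exact: int_spectral_nil.
have [|s [M [d [Q [U S]]]]] := IH; first by move=> q qps; apply: H; rewrite inE qps orbT.
have [pm ip] := H _ (mem_head _ _).
have [d1 [Q1 [U1 S1]]] := companion_spectral C pm ip.
by exists ((size p).-1 + s)%N, (block_mx (companionmx p) 0 0 M), (row_mx d1 d),
  (block_mx Q1 0 0 Q), (block_mx U1 0 0 U); exact: (int_spectral_cat S1 S).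
Qed.

Lemma minpoly_int_uniq (C : numFieldType) (z : C) (p q : {poly int}) :
  p \is monic -> irreducible_poly (map_poly intr p : {poly rat}) ->
  q \is monic -> irreducible_poly (map_poly intr q : {poly rat}) ->
  root (map_poly intr p) z -> root (map_poly intr q) z -> p = q.
Proof.
move=> pm ip qm iq; rewrite -(@map_ratr_intr C p) -(@map_ratr_intr C q) => pz qz.
have pq : (map_poly intr p : {poly rat}) %= map_poly intr q.
  by apply/andP; split; [exact: minpoly_dvd ip pz qz | exact: minpoly_dvd iq qz pz].
have pqE : (map_poly intr p : {poly rat}) = map_poly intr q.
  by apply/eqP; rewrite -eqp_monic ?monic_map.
apply/polyP => i; move/polyP/(_ i): pqE; rewrite !coef_map /=; exact: intr_inj.
Qed.

(** Each minimal polynomial of the [a i] is repeated. If it has a root of modulus above 1, it occurs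
    as often as that root does among the [a i], which by hypothesis is the largest multiplicity of
    its roots and is not reached by all of them. Otherwise it occurs [n.+1] times, more than any
    multiplicity. *)
Lemma class_list_exists (C : numFieldType) n (a : 'I_n -> C) :
  let m nu := #|[pred i | a i == nu]| in
  (forall i, algebraic_integer (a i)) ->
  (forall mu, 1 < `|mu| -> (exists i, alg_conjugate (a i) mu) ->
     (forall nu, alg_conjugate mu nu -> (m nu <= m mu)%N) /\
     (exists nu, alg_conjugate mu nu /\ (m nu < m mu)%N)) ->
  exists ps : seq {poly int},
    let k nu := count (fun p => root (map_poly intr p) nu) ps in
  [/\ forall p, p \in ps -> p \is monic /\ irreducible_poly (map_poly intr p : {poly rat}),
    forall nu, (m nu <= k nu)%N,
    forall nu, 1 < `|nu| -> m nu = k nu,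
    forall p, p \in ps -> exists i, root (map_poly intr p) (a i) &
    forall p, p \in ps -> exists nu, root (map_poly intr p) nu /\ (m nu < k nu)%N].
Proof.
move=> m P1 P2.
have [f Hf] := choice (fun i => minpoly_int_exists (P1 i)).
pose pl := undup [seq f i | i <- enum 'I_n].
have plP p : p \in pl -> exists i, p = f i.
  by rewrite mem_undup => /mapP[i _ ->]; exists i.
have fpl i : f i \in pl by rewrite mem_undup map_f // mem_enum.
have plm p : p \in pl -> p \is monic by move=> /plP[i ->]; case: (Hf i).
have pli p : p \in pl -> irreducible_poly (map_poly intr p : {poly rat}).
  by move=> /plP[i ->]; case: (Hf i).
have plr p : p \in pl -> exists i, root (map_poly intr p) (a i).
  by move=> /plP[i ->]; exists i; case: (Hf i).
have conjI p (mu nu : C) : p \in pl -> root (map_poly intr p) mu -> root (map_poly intr p) nu ->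
    alg_conjugate mu nu.
  move=> ppl pmu pnu; exists (map_poly intr p).
  have rr (z : C) : root (map_poly intr p) z -> root (map_poly ratr (map_poly intr p : {poly rat})) z.
    by rewrite map_ratr_intr.
  split; [by rewrite monic_map ?plm | exact: pli | exact: rr | exact: rr].
have exk p : exists k, p \in pl -> [/\ forall nu, root (map_poly intr p) nu -> (m nu <= k)%N,
    forall nu, root (map_poly intr p) nu -> 1 < `|nu| -> m nu = k &
    exists nu, root (map_poly intr p) nu /\ (m nu < k)%N].
  have [[mu [mu1 pmu]]|N] := pselect (exists mu : C, 1 < `|mu| /\ root (map_poly intr p) mu).
    exists (m mu) => ppl; have [i pai] := plr _ ppl.
    have [|H1 [nu [cnu nult]]] := P2 mu mu1; first by exists i; exact: conjI pai pmu.
    split; first by move=> nu' pnu'; apply: H1; exact: conjI pmu pnu'.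
      move=> nu' pnu' nu'1; apply/eqP; rewrite eqn_leq H1 //=; last exact: conjI pmu pnu'.
      (* Two conjugates of modulus above 1 bound each other's multiplicities. *)
      have [|H1' _] := P2 nu' nu'1; first by exists i; exact: conjI pai pnu'.
      by apply: H1'; exact: conjI pnu' pmu.
    (* The irreducible [q] has the root [mu] of [p], hence divides [p], and [nu] is a root of [p] as
       well. *)
    exists nu; split => //; case: cnu => q [qm iq qmu qnu].
    rewrite -map_ratr_intr; have := qnu.
    by have /dvdpP[h ->] : q %| map_poly intr p;
      [rewrite (minpoly_dvd iq qmu) // map_ratr_intr | rewrite rmorphM rootM => ->; rewrite orbT].
  exists n.+1 => ppl; have mn nu : (m nu < n.+1)%N.
    by rewrite ltnS -[n in (_ <= n)%N]card_ord max_card.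
  split; first by move=> nu _; exact: ltnW.
    by move=> nu pnu nu1; case: N; exists nu.
  by have [i pai] := plr _ ppl; exists (a i).
have [k Hk] := choice exk.
pose ps := flatten [seq nseq (k p) p | p <- pl].
have pspl p : p \in ps -> p \in pl.
  by move=> /flattenP[_ /mapP[q qpl ->]]; rewrite mem_nseq => /andP[_ /eqP ->].
have cnt (nu : C) : count (fun p => root (map_poly intr p) nu) ps =
    (\sum_(p <- pl) root (map_poly intr p) nu * k p)%N.
  rewrite count_flatten sumnE !big_map; apply: eq_bigr => p _.
  by rewrite count_nseq.
have cntk p (nu : C) : p \in pl -> root (map_poly intr p) nu ->
    count (fun p => root (map_poly intr p) nu) ps = k p.
  move=> ppl pnu; rewrite cnt (bigD1_seq p) ?undup_uniq //= pnu mul1n.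
  rewrite big_seq_cond big1 ?addn0 // => q /andP[qpl qp].
  have [qnu|//] := boolP (root _ _).
  by move: qp; rewrite (minpoly_int_uniq (plm _ qpl) (pli _ qpl) (plm _ ppl) (pli _ ppl) qnu pnu) eqxx.
have noroot (nu : C) : ~ (exists2 p, p \in pl & root (map_poly intr p) nu) ->
    m nu = 0%N /\ count (fun p => root (map_poly intr p) nu) ps = 0%N.
  move=> N; split.
    apply: eq_card0 => i; rewrite inE; apply/negP => /eqP ai; apply: N.
    by exists (f i); rewrite // -ai; case: (Hf i).
  rewrite cnt big_seq_cond big1 // => p /andP[ppl _].
  by have [pnu|//] := boolP (root _ _); case: N; exists p.
exists ps; split.
- by move=> p /pspl ppl; split; [exact: plm | exact: pli].
- move=> nu; have [[p ppl pnu]|/noroot[-> _]//] := pselect (exists2 p, p \in pl & root (map_poly intr p) nu).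
  by rewrite (cntk p) //; have [H _ _] := Hk p ppl; exact: H.
- move=> nu nu1; have [[p ppl pnu]|/noroot[-> ->]//] := pselect (exists2 p, p \in pl & root (map_poly intr p) nu).
  by rewrite (cntk p) //; have [_ H _] := Hk p ppl; exact: H.
- by move=> p /pspl /plr.
- move=> p /pspl ppl; have [_ _ [nu [pnu lt]]] := Hk p ppl.
  by exists nu; rewrite (cntk p).
Qed.

(** * Generic splittings *)

(** Each polynomial excludes finitely many real [t], and a countable set has Lebesgue measure 0,
    unlike the unit interval. *)
Lemma countable_poly_avoid (R : realType) (J : countType) (P : J -> {poly R[i]}) :
  (forall j, P j != 0) -> exists t : R, forall j, ~~ root (P j) (t%:C)%C.
Proof.
move=> P0; apply: contrapT => N.
have cZ : countable (\bigcup_(j in [set: J]) [set t : R | root (P j) (t%:C)%C]).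
  apply: bigcup_countable => // j _; apply: finite_set_countable.
  have [rs PE] := closed_field_poly_normal (P j).
  apply: (@sub_finite_set _ _ [set` [seq complex.Re z | z <- rs]]).
    move=> t /=; rewrite PE rootZ ?lead_coef_eq0 // root_prod_XsubC => trs.
    by apply/mapP; exists (t%:C)%C.
  exact: finite_seq.
have c01 : countable `[0 : R, 1].
  apply: sub_countable cZ; apply: subset_card_le => t _.
  apply: contrapT => Nt; apply: N; exists t => j; apply/negP => jt.
  by apply: Nt; exists j.
have := countable_lebesgue_measure0 c01.
rewrite lebesgue_measure_itv /= lte_fin ltr01 oppr0 adde0 => /eqP.
by rewrite eqe oner_eq0.
Qed.

(** Along the curve each condition is a polynomial in [t]. Distinct exponents keep the coefficients
    apart, and starting them at 1 leaves [g0 j] as the constant term. [P0] carries one further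
    condition, such as a nonzero determinant. *)
Lemma generic_power (R : realType) (T : finType) (J : countType)
    (g0 : J -> R[i]) (g : J -> T -> R[i]) (P0 : {poly R[i]}) :
  P0 != 0 -> (forall j, g0 j != 0 \/ exists k, g j k != 0) ->
  exists t : R, ~~ root P0 (t%:C)%C /\
    forall j, g0 j + \sum_k (t%:C)%C ^+ (enum_rank k).+1 * g j k != 0.
Proof.
move=> P00 gn0.
pose P j : {poly R[i]} := (g0 j)%:P + \sum_k g j k *: 'X^((enum_rank k).+1).
have P0' j : P j != 0.
  have coef0P : (P j)`_0 = g0 j.
    rewrite coefD coefC coef_sum big1 ?addr0 // => k _.
    by rewrite coefZ coefXn mulr0.
  have coefP k : (P j)`_(enum_rank k).+1 = g j k.
    rewrite coefD coefC coef_sum add0r (bigD1 k) //= coefZ coefXn eqxx mulr1.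
    rewrite big1 ?addr0 // => l lk; rewrite coefZ coefXn eqSS.
    case: eqP => [/val_inj/enum_rank_inj kl|_]; last by rewrite mulr0.
    by move: lk; rewrite kl eqxx.
  apply/eqP => Pj; have [/eqP[]|[k /eqP[]]] := gn0 j.
    by rewrite -coef0P Pj coef0.
  by rewrite -coefP Pj coef0.
have [|t Ht] := @countable_poly_avoid R (option J) (fun j => if j is Some j then P j else P0).
  by case.
exists t; split; first exact: (Ht None).
move=> j; have := Ht (Some j); rewrite rootE /P hornerD hornerC horner_sum.
by under eq_bigr => k _ do rewrite hornerZ hornerXn mulrC.
Qed.

(** Turns invertibility along a curve of matrices into the nonvanishing of a polynomial, as wanted
    for [P0] in [generic_power]. *)
Lemma det_power_poly (F : comNzRingType) (T : finType) n (Y0 : 'M[F]_n) (Y : T -> 'M[F]_n) :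
  exists P : {poly F}, forall x,
    P.[x] = \det (Y0 + \sum_k x ^+ (enum_rank k).+1 *: Y k).
Proof.
exists (\det (map_mx polyC Y0 + \sum_k 'X^((enum_rank k).+1) *: map_mx polyC (Y k))) => x.
rewrite -[LHS]/(horner_eval x _) -det_map_mx; congr (\det _).
apply/matrixP => i j; rewrite !mxE !summxE -[LHS]/(_.[x]) hornerD hornerC horner_sum.
congr (_ + _); apply: eq_bigr => k _.
by rewrite !mxE hornerM hornerXn hornerC.
Qed.

(** Each [i] is sent to the element of the [g]-fibre that has the same position as [i] has in its
    [f]-fibre. *)
Lemma fiber_injection (I J : finType) (T : eqType) (f : I -> T) (g : J -> T) :
  (forall t, #|[pred i | f i == t]| <= #|[pred j | g j == t]|)%N ->
  exists h : I -> J, injective h /\ forall i, g (h i) = f i.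
Proof.
move=> H.
pose e i := enum [pred i' | f i' == f i]; pose e' i := enum [pred j | g j == f i].
have idx i : (index i (e i) < size (e' i))%N.
  rewrite -cardE; apply: leq_trans (H (f i)); rewrite cardE index_mem mem_enum.
  by rewrite inE.
have j0 (i : I) : J by move: (idx i); case: (e' i).
have hE (i : I) x0 : nth (j0 i) (e' i) (index i (e i)) = nth x0 (e' i) (index i (e i)).
  exact: set_nth_default (idx i).
exists (fun i => nth (j0 i) (e' i) (index i (e i))).
have gh i : g (nth (j0 i) (e' i) (index i (e i))) = f i.
  have := mem_nth (j0 i) (idx i); rewrite mem_enum inE => /eqP.
  by [].
split=> // i1 i2 h12; have f12 : f i1 = f i2 by rewrite -(gh i1) h12 gh.
have ee : e i1 = e i2 by rewrite /e f12.
have ee' : e' i1 = e' i2 by rewrite /e' f12.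
move: h12; rewrite (hE i2 (j0 i1)) -ee' => /eqP.
rewrite nth_uniq ?enum_uniq // ?ee' // => /eqP ii.
have m1 : i1 \in e i2 by rewrite -ee mem_enum inE.
have m2 : i2 \in e i2 by rewrite mem_enum inE.
by rewrite -(nth_index i1 m1) -[RHS](nth_index i1 m2) -ii ee.
Qed.

(* Both sides are the trace of the idempotent [T' T] on the eigenspace of [nu]. *)
Lemma fiber_trace (F : numDomainType) n s (a : 'rV[F]_n) (d : 'rV[F]_s)
    (T : 'M[F]_(n, s)) (T' : 'M[F]_(s, n)) nu :
  T *m T' = 1%:M ->
  (forall i l, a 0 i != d 0 l -> T i l = 0) ->
  (forall i l, a 0 i != d 0 l -> T' l i = 0) ->
  (forall l, d 0 l = nu -> (T' *m T) l l = 1) ->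
  #|[pred l | d 0 l == nu]| = #|[pred i | a 0 i == nu]|.
Proof.
move=> TT T0 T'0 H; apply/eqP; rewrite -(eqr_nat F); apply/eqP.
rewrite -!sum1_card !natr_sum.
transitivity (\sum_(l | d 0 l == nu) \sum_(i | a 0 i == nu) T' l i * T i l).
  apply: eq_bigr => l /eqP dl; rewrite -(H l dl) mxE (bigID (fun i => a 0 i == nu)) /=.
  rewrite [X in _ + X]big1 ?addr0 // => i ai; rewrite T0 ?mulr0 // dl; exact: ai.
rewrite exchange_big; apply: eq_bigr => i /eqP ai.
have := congr1 (fun X : 'M[F]_n => X i i) TT.
rewrite [X in _ = X]mxE eqxx => /= <-; rewrite mxE [RHS](bigID (fun l => d 0 l == nu)) /=.
rewrite [X in _ = _ + X]big1 ?addr0 => [|l dl]; last by rewrite T0 ?mul0r // ai eq_sym.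
by apply: eq_bigr => l _; rewrite mulrC.
Qed.

Section RealParts.
Variable R : realType.
Implicit Types (b : bool) (z : R[i]).

(** Real and imaginary part under one boolean index: a complex solution of a linear system with real
    coefficients yields two real solutions, treated alike. *)
Definition part b : R[i] -> R := if b then @complex.Re R else @complex.Im R.

Lemma partD b : {morph part b : x y / x + y}.
Proof. by case: b => -[? ?] [? ?]. Qed.

Lemma part0 b : part b 0 = 0. Proof. by case: b. Qed.

Lemma partMl b (x : R) z : part b (x%:C%C * z) = x * part b z.
Proof. by case: b z => -[u v] /=; rewrite mul0r ?subr0 ?addr0. Qed.

Lemma part_neq0 z : z != 0 -> exists b, part b z != 0.
Proof.
move=> z0; apply: contrapT => N; move: z0; rewrite eq_complex negb_and => /orP[h|h].
  by apply: N; exists true.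
by apply: N; exists false.
Qed.

Lemma map_part_mull b m n p (X : 'M[R]_(m, n)) (Y : 'M[R[i]]_(n, p)) :
  map_mx (part b) (map_mx (real_complex R) X *m Y) = X *m map_mx (part b) Y.
Proof.
apply/matrixP => i j; rewrite !mxE (big_morph _ (partD b) (part0 b)).
by apply: eq_bigr => k _; rewrite !mxE partMl.
Qed.

Lemma map_part_mulr b m n p (X : 'M[R[i]]_(m, n)) (Y : 'M[R]_(n, p)) :
  map_mx (part b) (X *m map_mx (real_complex R) Y) = map_mx (part b) X *m Y.
Proof.
apply/matrixP => i j; rewrite !mxE (big_morph _ (partD b) (part0 b)).
by apply: eq_bigr => k _; rewrite !mxE mulrC partMl mulrC.
Qed.

Lemma map_part_real m n (X : 'M[R]_(m, n)) :
  map_mx (part true) (map_mx (real_complex R) X) = X.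
Proof. by apply/matrixP => i j; rewrite !mxE. Qed.

Lemma map_partE m n (X : 'M[R[i]]_(m, n)) :
  X = map_mx (real_complex R) (map_mx (part true) X) +
      'i%C *: map_mx (real_complex R) (map_mx (part false) X).
Proof. by apply/matrixP => i j; rewrite !mxE /= -complexE. Qed.

End RealParts.

Lemma generic_power_real (R : realType) (T : finType) (J : countType)
    (g0 : J -> R) (g : J -> T -> R) (P0 : {poly R[i]}) :
  P0 != 0 -> (forall j, g0 j != 0 \/ exists k, g j k != 0) ->
  exists t : R, P0.[t%:C%C] != 0 /\
    forall j, g0 j + \sum_k t ^+ (enum_rank k).+1 * g j k != 0.
Proof.
move=> P00 H; have [|t [tP Ht]] := @generic_power R T J (fun j => (g0 j)%:C%C)
    (fun j k => (g j k)%:C%C) P0 P00.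
  move=> j; have [h|[k h]] := H j; [left|right; exists k].
    by rewrite (fmorph_eq0 (real_complex R)).
  by rewrite (fmorph_eq0 (real_complex R)).
exists t; split=> // j; rewrite -(fmorph_eq0 (real_complex R)) rmorphD rmorph_sum /=.
have := Ht j; rewrite (eq_bigr (fun k => (real_complex R (t ^+ (enum_rank k).+1 * g j k)))) //.
by move=> k _; rewrite rmorphM rmorphXn.
Qed.

Section Splitting.
Variables (R : realType) (n s : nat) (A : 'M[R]_n) (QA UA : 'M[R[i]]_n) (a : 'rV[R[i]]_n).
Variables (ps : seq {poly int}) (M : 'M[int]_s) (d : 'rV[R[i]]_s) (Q U : 'M[R[i]]_s).
Notation cx := (map_mx (real_complex R)).
Notation ir := (map_mx (intr : int -> R)).
Let cM : 'M[R[i]]_s := map_mx intr M.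
Hypothesis QUA : QA *m UA = 1%:M.
Hypothesis AUA : cx A *m UA = UA *m diag_mx a.
Hypothesis SP : int_spectral ps M d Q U.
Hypothesis mult_le : forall nu, (#|[pred i | a 0%R i == nu]| <= #|[pred l | d 0%R l == nu]|)%N.
Hypothesis ps_root : forall p, p \in ps -> exists i, root (map_poly intr p) (a 0 i).
Hypothesis ps_lt : forall p, p \in ps -> exists nu, root (map_poly intr p) nu /\
  (#|[pred i | a 0%R i == nu]| < #|[pred l | d 0%R l == nu]|)%N.

Let cMir : cx (ir M) = cM.
Proof. by apply/matrixP => i j; rewrite !mxE /= rmorph_int. Qed.

Let QU : Q *m U = 1%:M. Proof. by case: SP. Qed.
Let UQ : U *m Q = 1%:M. Proof. exact: mulmx1C QU. Qed.
Let UAQA : UA *m QA = 1%:M. Proof. exact: mulmx1C QUA. Qed.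
Let MU : cM *m U = U *m diag_mx d. Proof. by case: SP. Qed.

Let QM : Q *m cM = diag_mx d *m Q.
Proof. by rewrite -[LHS]mulmx1 -UQ mulmxA -[Q *m cM *m U]mulmxA MU !mulmxA QU mul1mx. Qed.

Let QAA : QA *m cx A = diag_mx a *m QA.
Proof. by rewrite -[LHS]mulmx1 -UAQA mulmxA -[QA *m _ *m UA]mulmxA AUA !mulmxA QUA mul1mx. Qed.

Lemma int_vector_split (r : 'cV[int]_s) : r != 0 -> exists2 p, p \in ps &
  forall nu, root (map_poly intr p) nu -> exists l, d 0 l = nu /\ (Q *m cx (ir r)) l 0 != 0.
Proof.
move=> r0; have r0' : map_mx intr r != 0 :> 'cV[rat]_s.
  apply: contra_neq r0 => r0; apply/colP => i; move/colP/(_ i): r0; rewrite !mxE => /eqP.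
  by rewrite intr_eq0 => /eqP.
have -> : cx (ir r) = map_mx ratr (map_mx intr r : 'cV[rat]_s).
  by apply/matrixP => i j; rewrite !mxE /= rmorph_int ratr_int.
by case: SP => _ _ _ H _; exact: H.
Qed.

Lemma int_covector_split (z : 'rV[int]_s) : z != 0 -> exists2 p, p \in ps &
  forall nu, root (map_poly intr p) nu -> exists l, d 0 l = nu /\ (cx (ir z) *m U) 0 l != 0.
Proof.
move=> r0; have r0' : map_mx intr z != 0 :> 'rV[rat]_s.
  apply: contra_neq r0 => r0; apply/rowP => i; move/rowP/(_ i): r0; rewrite !mxE => /eqP.
  by rewrite intr_eq0 => /eqP.
have -> : cx (ir z) = map_mx ratr (map_mx intr z : 'rV[rat]_s).
  by apply/matrixP => i j; rewrite !mxE /= rmorph_int ratr_int.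
by case: SP => _ _ _ _ H; exact: H.
Qed.

Let diag_delta (m p : nat) (e : 'rV[R[i]]_m) i (j : 'I_p) :
  diag_mx e *m delta_mx i j = e 0 i *: delta_mx i j.
Proof.
rewrite mul_diag_mx; apply/matrixP => u v; rewrite !mxE.
by case: (u =P i) => [->|]; rewrite /= ?mulr0.
Qed.

Let delta_diag (m p : nat) (e : 'rV[R[i]]_p) (i : 'I_m) j :
  delta_mx i j *m diag_mx e = e 0 j *: delta_mx i j.
Proof.
rewrite mul_mx_diag; apply/matrixP => u v; rewrite !mxE mulrC.
by case: (v =P j) => [->|]; rewrite ?andbF /= ?mulr0.
Qed.

Let delta_entry (m p q r : nat) (X : 'M[R[i]]_(m, p)) i j (Y : 'M[R[i]]_(q, r)) u v :
  (X *m delta_mx i j *m Y) u v = X u i * Y j v.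
Proof.
rewrite mxE (bigD1 j) //= big1 ?addr0 => [|k kj].
  rewrite mxE (bigD1 i) //= big1 ?addr0 => [|k ki]; rewrite !mxE ?eqxx ?mulr1 //.
  by rewrite (negbTE ki) mulr0.
rewrite mxE big1 ?mul0r // => l _; rewrite mxE (negbTE kj) andbF mulr0 //.
Qed.

(** Matrix units in the eigenbases of [A] and [M], kept only between equal eigenvalues, where they
    intertwine the two matrices. *)
Let XB (k : 'I_n * 'I_s) : 'M[R[i]]_(n, s) :=
  if a 0 k.1 == d 0 k.2 then UA *m delta_mx k.1 k.2 *m Q else 0.

Let XBcomm k : cx A *m XB k = XB k *m cM.
Proof.
rewrite /XB; case: eqP => [ad|]; last by rewrite mulmx0 mul0mx.
rewrite !mulmxA AUA -[UA *m _ *m delta_mx _ _]mulmxA diag_delta.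
by rewrite -[RHS]mulmxA QM mulmxA -[UA *m _ *m diag_mx d]mulmxA delta_diag ad.
Qed.

Let commB b (X : 'M[R[i]]_(n, s)) : cx A *m X = X *m cM ->
  A *m map_mx (part b) X = map_mx (part b) X *m ir M.
Proof. by move=> AX; rewrite -map_part_mull AX -cMir map_part_mulr. Qed.

(** The multiplicity hypothesis embeds the eigenvalues of [A] among those of [M]. In the eigenbases,
    [B0] is the 0-1 matrix [S] of this embedding and [F0] its transpose. *)
Let base : exists (B0 : 'M[R[i]]_(n, s)) (F0 : 'M[R[i]]_(s, n)),
  [/\ cx A *m B0 = B0 *m cM, cM *m F0 = F0 *m cx A & B0 *m F0 = 1%:M].
Proof.
have [h [hI hE]] := fiber_injection (f := a 0) (g := d 0) mult_le.
pose S : 'M[R[i]]_(n, s) := \matrix_(i, l) (l == h i)%:R.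
have aS : diag_mx a *m S = S *m diag_mx d.
  rewrite mul_diag_mx mul_mx_diag; apply/matrixP => i l; rewrite !mxE.
  by case: (l =P h i) => [->|_]; rewrite ?mulr0 ?mul0r // hE mulrC.
have SS : S *m S^T = 1%:M.
  apply/matrixP => i j; rewrite !mxE (bigD1 (h i)) //= big1 ?addr0 => [|k kh].
    by rewrite !mxE eqxx mul1r (inj_eq hI) eq_sym.
  by rewrite !mxE (negbTE kh) mul0r.
exists (UA *m S *m Q), (U *m S^T *m QA); split.
- by rewrite !mulmxA AUA -[UA *m _ *m S]mulmxA aS -[RHS]mulmxA QM !mulmxA.
- rewrite !mulmxA MU -[RHS]mulmxA QAA !mulmxA -[U *m _ *m S^T]mulmxA -[U *m S^T *m _]mulmxA.
  by rewrite -[diag_mx d]tr_diag_mx -[diag_mx a]tr_diag_mx -!trmx_mul aS.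
- by rewrite !mulmxA -[UA *m S *m Q *m U]mulmxA QU mulmx1 -[UA *m S *m _]mulmxA SS mulmx1.
Qed.

(** With [X] and [Y] the real and imaginary parts of [B0], the polynomial [det ((X + t Y) F0)] is 1
    at the imaginary unit, hence is nonzero at some real [t]. *)
Let Bbase (B0 : 'M[R[i]]_(n, s)) (F0 : 'M[R[i]]_(s, n)) : cx A *m B0 = B0 *m cM -> B0 *m F0 = 1%:M ->
  exists B : 'M[R]_(n, s), A *m B = B *m ir M /\ \det (cx B *m F0) != 0.
Proof.
move=> AB BF.
have [P0 P0E] := @det_power_poly R[i] unit n (cx (map_mx (part true) B0) *m F0)
   (fun=> cx (map_mx (part false) B0) *m F0).
have rk : enum_rank tt = 0%N :> nat.
  by apply/eqP; rewrite -leqn0 -ltnS -[X in (_ < X)%N]card_unit ltn_ord.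
have [||t [tP _]] := @generic_power_real R unit void (fun=> 0) (fun _ _ => 0) P0.
- apply/eqP => P00; have := P0E 'i%C; rewrite P00 horner0.
  rewrite (bigD1 tt) //= big1 ?addr0 => [|[]//]; rewrite rk expr1 scalemxAl -mulmxDl -map_partE BF det1.
  by move/eqP; rewrite eq_sym oner_eq0.
- by case.
exists (map_mx (part true) B0 + t *: map_mx (part false) B0); split.
  by rewrite mulmxDr mulmxDl -scalemxAr -scalemxAl !commB.
move: tP; rewrite P0E (bigD1 tt) //= big1 ?addr0 => [|[]//].
by rewrite rk expr1 scalemxAl -mulmxDl map_mxD map_mxZ.
Qed.

(** Perturbs the real intertwiner of [Bbase] by the real and imaginary parts of all [XB], keeping
    the determinant nonzero. [F0] stays complex at this stage. *)
Lemma generic_projection : exists (B : 'M[R]_(n, s)) (F0 : 'M[R[i]]_(s, n)),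
  [/\ A *m B = B *m ir M, cM *m F0 = F0 *m cx A, cx B *m F0 \in unitmx &
    forall r : 'cV[int]_s, r != 0 -> B *m ir r != 0].
Proof.
have [B0 [F0 [AB0 MF0 BF0]]] := base.
have [Bb [ABb detBb]] := Bbase AB0 BF0.
pose T : finType := (bool * ('I_n * 'I_s))%type.
pose X (k : T) : 'M[R]_(n, s) := map_mx (part k.1) (XB k.2).
have [P0 P0E] := @det_power_poly R[i] T n (cx Bb *m F0) (fun k => cx (X k) *m F0).
have P00 : P0 != 0.
  apply: contra_neq detBb => P00; have := P0E 0; rewrite P00 horner0 big1 ?addr0 // => k _.
  by rewrite expr0n /= scale0r.
pose J : countType := {r : 'cV[int]_s | r != 0}.
(* By [ps_root] and Galois symmetry, [r] has a nonzero eigencoordinate [l] at some eigenvalue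
   [a 0 i0] of [A]; then [XB (i0, l)] does not kill [r]. *)
have HJ (j : J) : exists i, exists k, (X k *m ir (val j)) i 0 != 0.
  have [p pps Hp] := int_vector_split (valP j).
  have [i0 pi0] := ps_root pps; have [l [dl Ql]] := Hp _ pi0.
  have [u Uu] : exists u, UA u i0 != 0.
    apply: contrapT => N; have := congr1 (fun X : 'M[R[i]]_n => X i0 i0) QUA.
    rewrite !mxE eqxx big1 => [/eqP|u _]; first by rewrite eq_sym oner_eq0.
    have -> : UA u i0 = 0 by apply/eqP/negPn/negP => h; apply: N; exists u.
    by rewrite mulr0.
  have E : (XB (i0, l) *m cx (ir (val j))) u 0 != 0.
    by rewrite /XB /= -dl eqxx -mulmxA delta_entry mulf_neq0.
  have [b Eb] := part_neq0 E.
  exists u, (b, (i0, l)); rewrite -map_part_mulr mxE; exact: Eb.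
have [ci Hci] := choice HJ.
have [|t [tP Ht]] := @generic_power_real R T J (fun j => (Bb *m ir (val j)) (ci j) 0)
  (fun j k => (X k *m ir (val j)) (ci j) 0) P0 P00.
  by move=> j; right; exact: Hci.
pose B := Bb + \sum_k t ^+ (enum_rank k).+1 *: X k.
exists B, F0; split.
- rewrite mulmxDr mulmxDl ABb mulmx_sumr mulmx_suml; congr (_ + _).
  by apply: eq_bigr => k _; rewrite -scalemxAr -scalemxAl commB // XBcomm.
- exact: MF0.
- rewrite unitmxE unitfE; move: tP; rewrite P0E; congr (\det _ != 0).
  rewrite map_mxD mulmxDl map_mx_sum mulmx_suml; congr (_ + _).
  by apply: eq_bigr => k _; rewrite map_mxZ rmorphXn -scalemxAl.
- move=> r r0; have := Ht (exist _ r r0 : J); apply: contra_neq => /= Br.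
  transitivity ((B *m ir r) (ci (exist _ r r0)) 0); last by rewrite Br mxE.
  rewrite /B mulmxDl [RHS]mxE mulmx_suml summxE; congr (_ + _).
  by apply: eq_bigr => k _; rewrite -scalemxAl [RHS]mxE.
Qed.

(** With [B] fixed, [F0] is normalised to a right inverse and replaced by its real part, which
    remains one since [B] is real. It is then perturbed by intertwiners that [B] kills. *)
Lemma generic_splitting : exists (B : 'M[R]_(n, s)) (F : 'M[R]_(s, n)),
  [/\ A *m B = B *m ir M, ir M *m F = F *m A, B *m F = 1%:M,
    forall r : 'cV[int]_s, r != 0 -> B *m ir r != 0 &
    (forall z : 'rV[int]_s, z != 0 -> ir z *m F != 0) /\
    (forall r : 'cV[int]_s, r != 0 -> F *m (B *m ir r) != ir r)].
Proof.
have [B [F0 [AB MF0 uBF Br0]]] := generic_projection.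
have cAB : cx A *m cx B = cx B *m cM by rewrite -map_mxM AB map_mxM cMir.
pose G := cx B *m F0; pose F0' := F0 *m invmx G.
(* [G] commutes with [A], so dividing by it preserves the intertwining relation. *)
have AG : cx A *m G = G *m cx A by rewrite /G mulmxA cAB -!mulmxA MF0.
have AVG : invmx G *m cx A = cx A *m invmx G.
  have uG : G \in unitmx := uBF.
  have : G *m (invmx G *m cx A) = G *m (cx A *m invmx G).
    by rewrite mulKVmx // mulmxA -AG mulmxK.
  by move/(congr1 (mulmx (invmx G))); rewrite !mulKmx.
have BF0' : cx B *m F0' = 1%:M by rewrite mulmxA mulmxV.
have MF0' : cM *m F0' = F0' *m cx A by rewrite /F0' mulmxA MF0 -!mulmxA AVG.
pose F1 := map_mx (part true) F0'.
have BF1 : B *m F1 = 1%:M by rewrite -map_part_mull BF0' -(map_mx1 (real_complex R)) map_part_real.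
have MF1 : ir M *m F1 = F1 *m A by rewrite -map_part_mull cMir MF0' map_part_mulr.
pose cB := cx B; pose cF := cx F1.
have cBF : cB *m cF = 1%:M by rewrite -map_mxM BF1 map_mx1.
have cMF : cM *m cF = cF *m cx A by rewrite -cMir -!map_mxM MF1.
(* The projection onto the kernel of [B] along the image of [F1]. Composing matrix units with it
   gives the directions [Z] in which [F1] can move while [B F = 1] is kept. *)
pose P := 1%:M - cF *m cB.
have MP : cM *m P = P *m cM.
  by rewrite mulmxBr mulmxBl mulmx1 mul1mx mulmxA cMF -!mulmxA cAB.
have BP : cB *m P = 0 by rewrite mulmxBr mulmx1 mulmxA cBF mul1mx subrr.
pose Z (k : 'I_s * 'I_n) : 'M[R[i]]_(s, n) :=
  if d 0 k.1 == a 0 k.2 then P *m U *m delta_mx k.1 k.2 *m QA else 0.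
have BZ k : cB *m Z k = 0.
  by rewrite /Z; case: eqP => _; rewrite ?mulmx0 // !mulmxA BP !mul0mx.
have MZ k : cM *m Z k = Z k *m cx A.
  rewrite /Z; case: eqP => [da|]; last by rewrite mulmx0 mul0mx.
  rewrite !mulmxA MP -[P *m cM *m U]mulmxA MU -!mulmxA QAA.
  by rewrite [diag_mx d *m _]mulmxA diag_delta [delta_mx _ _ *m (_ *m _)]mulmxA delta_diag da.
pose T : finType := (bool * ('I_s * 'I_n))%type.
pose X (k : T) : 'M[R]_(s, n) := map_mx (part k.1) (Z k.2).
have BX k : B *m X k = 0.
  by rewrite -map_part_mull BZ; apply/matrixP => i j; rewrite !mxE part0.
have MX k : ir M *m X k = X k *m A by rewrite -map_part_mull cMir MZ map_part_mulr.
pose J1 : countType := {z : 'rV[int]_s | z != 0}.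
pose J2 : countType := {r : 'cV[int]_s | r != 0}.
(* If [z F1 = 0] then [z P = z], and a nonzero eigencoordinate of [z] at an eigenvalue of [A] makes
   [z Z] nonzero for a suitable index. *)
have H1 (j : J1) : exists i, (ir (val j) *m F1) 0 i != 0 \/ exists k, (ir (val j) *m X k) 0 i != 0.
  have [p pps Hp] := int_covector_split (valP j).
  have [i0 pi0] := ps_root pps; have [l [dl zl]] := Hp _ pi0.
  apply: contrapT => N.
  have zF : ir (val j) *m F1 = 0.
    apply/rowP => i; rewrite [RHS]mxE; apply/eqP/negPn/negP => h.
    by apply: N; exists i; left.
  have zZ : cx (ir (val j)) *m Z (l, i0) = 0.
    apply/rowP => i; rewrite [RHS]mxE; apply/eqP/negPn/negP => h.
    have [b hb] := part_neq0 h.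
    apply: N; exists i; right; exists (b, (l, i0)); rewrite -map_part_mull mxE; exact: hb.
  have := congr1 (mulmx^~ UA) zZ; rewrite /Z /= dl eqxx mul0mx => /rowP/(_ i0).
  rewrite !mulmxA -[_ *m QA *m UA]mulmxA QUA mulmx1.
  have -> : cx (ir (val j)) *m P = cx (ir (val j)).
    by rewrite mulmxBr mulmx1 mulmxA -map_mxM zF map_mx0 mul0mx subr0.
  rewrite -[_ *m delta_mx _ _]mulmx1 delta_entry !mxE eqxx mulr1 => /eqP.
  move: zl; rewrite mxE => /negbTE -> //.
(* If all conditions for [r] failed, then [F1 B r = r] and every [Z k] would kill [B r]. This forces
   [P] to vanish on the eigenspace of [M] at [nu], so that [nu] has equal multiplicity in [A] and
   [M], against [ps_lt]. *)
have H2 (j : J2) : exists i, (F1 *m (B *m ir (val j)) - ir (val j)) i 0 != 0 \/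
    exists k, (X k *m (B *m ir (val j))) i 0 != 0.
  have [p pps Hp] := int_vector_split (valP j).
  have [nu [pnu nult]] := ps_lt pps; have [l [dl Ql]] := Hp _ pnu.
  apply: contrapT => N.
  set v := cx (ir (val j)) in Ql.
  have FBr : cF *m (cB *m v) = v.
    rewrite -!map_mxM; congr (cx _); apply/eqP; rewrite -subr_eq0; apply/eqP/colP => i.
    rewrite [RHS]mxE; apply/eqP/negPn/negP => h.
    by apply: N; exists i; left.
  have ZBr k : Z k *m (cB *m v) = 0.
    apply/colP => i; rewrite [RHS]mxE; apply/eqP/negPn/negP => h.
    have [b hb] := part_neq0 h.
    apply: N; exists i; right; exists (b, k).
    by move: hb; rewrite -map_mxM -map_part_mulr [in X in _ -> X]mxE.
  pose T1 := QA *m cB *m U; pose T1' := Q *m cF *m UA.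
  have TT : T1 *m T1' = 1%:M.
    by rewrite /T1 /T1' !mulmxA -[_ *m U *m Q]mulmxA UQ mulmx1 -[_ *m cB *m cF]mulmxA cBF mulmx1.
  have T10 i l' : a 0 i != d 0 l' -> T1 i l' = 0.
    move=> ad; have : diag_mx a *m T1 = T1 *m diag_mx d.
      by rewrite /T1 !mulmxA -QAA -[QA *m _ *m cB]mulmxA cAB -!mulmxA MU.
    rewrite mul_diag_mx mul_mx_diag => /matrixP/(_ i l').
    rewrite [LHS]mxE [RHS]mxE [RHS]mulrC => /eqP.
    by rewrite -subr_eq0 -mulrBl mulf_eq0 subr_eq0 (negbTE ad) => /eqP.
  have T1'0 i l' : a 0 i != d 0 l' -> T1' l' i = 0.
    move=> ad; have : diag_mx d *m T1' = T1' *m diag_mx a.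
      by rewrite /T1' !mulmxA -QM -[Q *m _ *m cF]mulmxA cMF -!mulmxA AUA.
    rewrite mul_diag_mx mul_mx_diag => /matrixP/(_ l' i).
    rewrite [LHS]mxE [RHS]mxE [RHS]mulrC => /eqP.
    by rewrite -subr_eq0 -mulrBl mulf_eq0 subr_eq0 eq_sym (negbTE ad) => /eqP.
  (* [F1] respects eigenspaces, so the nonzero coordinate of [r = F1 B r] at [nu] comes from one of
     [B r] at [nu]. *)
  have [i0 [ai0 w0]] : exists i, a 0 i = nu /\ (QA *m (cB *m v)) i 0 != 0.
    apply: contrapT => N'; move: Ql; rewrite -FBr.
    have -> : Q *m (cF *m (cB *m v)) = T1' *m (QA *m (cB *m v)).
      by rewrite /T1' !mulmxA -[_ *m UA *m QA]mulmxA UAQA mulmx1.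
    rewrite mxE big1 ?eqxx // => i _; have [ai|ai] := eqVneq (a 0 i) nu.
      have -> : (QA *m (cB *m v)) i 0 = 0 by apply/eqP/negPn/negP => h; apply: N'; exists i.
      by rewrite mulr0.
    by rewrite T1'0 ?mul0r // dl.
  have := @fiber_trace R[i] n s a d T1 T1' nu TT T10 T1'0.
  (* [Z (l', i0)] sends [B r] to a nonzero multiple of [P] applied to the eigenvector [l']; hence
     [P] kills that eigenvector and [T1' T1 = 1 - Q P U] fixes its coordinate vector. *)
  have h l' : d 0 l' = nu -> (T1' *m T1) l' l' = 1.
    move=> dl'; have PU : P *m (U *m delta_mx l' (0 : 'I_1)) = 0.
      have := ZBr (l', i0); rewrite /Z /= dl' ai0 eqxx -!mulmxA => ZB.
      have E : delta_mx l' i0 *m (QA *m (cB *m v)) = (QA *m (cB *m v)) i0 0 *: delta_mx l' (0 : 'I_1).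
        rewrite -(mul_delta_mx (0 : 'I_1)) -mulmxA -rowE [row _ _]mx11_scalar [_ 0 0]mxE.
        exact: mul_mx_scalar.
      move: ZB; rewrite E -!scalemxAr => /eqP.
      by rewrite scaler_eq0 (negbTE w0) => /eqP.
    have : T1' *m T1 *m delta_mx l' (0 : 'I_1) = delta_mx l' 0.
      have -> : T1' *m T1 = 1%:M - Q *m P *m U.
        rewrite /T1 /T1' /P mulmxBr mulmxBl mulmx1 QU opprB addrC subrK.
        by rewrite !mulmxA -[_ *m UA *m QA]mulmxA UAQA mulmx1.
      by rewrite mulmxBl mul1mx -!mulmxA PU mulmx0 subr0.
    rewrite -colE => /colP/(_ l'); rewrite mxE => ->.
    by rewrite mxE !eqxx.
  by move=> /(_ h) E; move: nult; rewrite E ltnn.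
have [c1 Hc1] := choice H1; have [c2 Hc2] := choice H2.
pose g0 (j : J1 + J2) : R := match j with
  | inl j => (ir (val j) *m F1) 0 (c1 j)
  | inr j => (F1 *m (B *m ir (val j)) - ir (val j)) (c2 j) 0 end.
pose g (j : J1 + J2) (k : T) : R := match j with
  | inl j => (ir (val j) *m X k) 0 (c1 j)
  | inr j => (X k *m (B *m ir (val j))) (c2 j) 0 end.
have [|t [_ Ht]] := @generic_power_real R T (J1 + J2)%type g0 g 1 (oner_neq0 _).
  by case=> j; [exact: Hc1 | exact: Hc2].
pose F := F1 + \sum_k t ^+ (enum_rank k).+1 *: X k.
exists B, F; split => //.
- rewrite mulmxDr mulmxDl MF1 mulmx_sumr mulmx_suml; congr (_ + _).
  by apply: eq_bigr => k _; rewrite -scalemxAr -scalemxAl MX.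
- rewrite mulmxDr BF1 mulmx_sumr big1 ?addr0 // => k _.
  by rewrite -scalemxAr BX scaler0.
split.
- move=> z z0; have := Ht (inl (exist _ z z0 : J1)); apply: contra_neq => /= zF.
  transitivity ((ir z *m F) 0 (c1 (exist _ z z0))); last by rewrite zF mxE.
  rewrite /F mulmxDr [RHS]mxE mulmx_sumr summxE; congr (_ + _).
  by apply: eq_bigr => k _; rewrite -scalemxAr [RHS]mxE.
- move=> r r0; have := Ht (inr (exist _ r r0 : J2)); apply: contra_neq => /= rF.
  transitivity ((F *m (B *m ir r) - ir r) (c2 (exist _ r r0)) 0); last by rewrite rF subrr mxE.
  rewrite /F mulmxDl mulmx_suml addrAC [RHS]mxE summxE; congr (_ + _).
  by apply: eq_bigr => k _; rewrite -scalemxAl [RHS]mxE.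
Qed.

End Splitting.

(** * Sufficiency *)

(** The rows of the projection [1 - F B] lie in the left kernel of [F], so it factors through a
    basis [E] of that kernel; the other factor is [G]. *)
Lemma split_complement (K : fieldType) n s (B : 'M[K]_(n, s)) (F : 'M[K]_(s, n)) :
  B *m F = 1%:M ->
  exists m (E : 'M[K]_(m, s)) (G : 'M[K]_(s, m)),
    [/\ (n + m = s)%N, E *m F = 0, E *m G = 1%:M, B *m G = 0 & F *m B + G *m E = 1%:M].
Proof.
move=> BF; pose P := 1%:M - F *m B.
have PF : P *m F = 0 by rewrite mulmxBl mul1mx -mulmxA BF mulmx1 subrr.
have BP : B *m P = 0 by rewrite mulmxBr mulmx1 mulmxA BF mul1mx subrr.
pose E := row_base (kermx F); pose G := P *m pinvmx E.
have GE : G *m E = P.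
  by rewrite mulmxKpV // eq_row_base; apply/sub_kermxP.
have EF : E *m F = 0 by apply/sub_kermxP; rewrite eq_row_base.
have fE : row_free E := row_base_free _.
exists (\rank (kermx F)), E, G; split => //.
- have rF : \rank F = n.
    apply/eqP; rewrite eqn_leq rank_leq_col /= -[X in (X <= _)%N](mxrank1 K n) -BF.
    exact: mxrankM_maxr.
  rewrite mxrank_ker rF subnKC //; rewrite -rF; exact: rank_leq_row.
- apply: (row_free_inj fE); rewrite -mulmxA GE mul1mx mulmxBr mulmx1 mulmxA EF mul0mx subr0 //.
- by apply: (row_free_inj fE); rewrite -mulmxA GE BP mul0mx.
- by rewrite GE addrC subrK.
Qed.

Lemma mup_prod_XsubC (K : fieldType) n (a : 'I_n -> K) nu :
  mup nu (\prod_i ('X - (a i)%:P)) = #|[pred i | a i == nu]|.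
Proof.
rewrite -sum1_card [RHS]big_mkcond /=.
elim: (index_enum _) => [|i r IH]; first by rewrite !big_nil mupNroot // root1.
rewrite !big_cons mupM ?polyXsubC_eq0 ?monic_neq0 ?monic_prod_XsubC // IH.
congr (_ + _)%N; rewrite -[X in mup _ X]expr1 mup_XsubCX inE.
by case: ifP.
Qed.

Lemma alg_mult_diag (K : fieldType) n (T P : 'M[K]_n) (a : 'rV[K]_n) nu :
  P \in unitmx -> P *m T = diag_mx a *m P ->
  alg_mult T nu = #|[pred i | a 0 i == nu]|.
Proof.
move=> uP PT; rewrite /alg_mult (char_poly_similar uP PT) char_poly_trig.
  by under eq_bigr => i _ do rewrite mxE eqxx mulr1n; rewrite mup_prod_XsubC.
exact/is_diag_mx_is_trig/diag_mx_is_diag.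
Qed.

Lemma alg_mult_gt0 (K : fieldType) n (T : 'M[K]_n) nu :
  (0 < alg_mult T nu)%N = eigenvalue T nu.
Proof.
rewrite eigenvalue_root_char -dvdp_XsubCl XsubC_dvd //.
by rewrite monic_neq0 ?char_poly_monic.
Qed.

(** Shrinking a point of the set by the factor [1 - dl] leaves room [dl] under all powers at once.
    Power boundedness then makes the shrunken point interior, with a ball of radius [dl / K1], and
    it is within [e] of the original. *)
Lemma power_bounded_window (R : realType) m (D : 'M[R]_m) K :
  (forall k (y : 'cV[R]_m), `|D ^+ k *m y| <= K * `|y|) ->
  window [set y : 'cV[R]_m | forall k, `|D ^+ k *m y| <= 1].
Proof.
move=> HK; pose K1 := `|K| + 1; have K10 : 0 < K1 by rewrite ltr_wpDl.
have {}HK k (y : 'cV[R]_m) : `|D ^+ k *m y| <= K1 * `|y|.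
  apply: le_trans (HK k y) _; rewrite ler_wpM2r //.
  by rewrite /K1; apply: le_trans (ler_norm K) _; rewrite lerDl.
set W := [set y : 'cV[R]_m | _].
have W1 y : W y -> `|y| <= 1 by move=> /(_ 0%N); rewrite expr0 mul1mx.
split.
- by exists 1; split; [exact: num_real | move=> M M1 y /W1 h; apply: le_trans h (ltW M1)].
- rewrite eqEsubset; split; first by apply: closureS; exact: interior_subset.
  have /closure_id -> : closed (closure (interior W)) by exact: closed_closure.
  apply: closureS => y Wy V /nbhs_ballP[e /= e0 He].
  pose dl := Num.min (e / 2) (2^-1).
  have dl0 : 0 < dl by rewrite lt_min divr_gt0 //= invr_gt0.
  have dle : dl < e by rewrite gt_min ltr_pdivrMr // ltr_pMr // ltr1n.
  have dl1 : dl <= 1 by rewrite ge_min invf_le1 // ler1n orbT.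
  exists ((1 - dl) *: y); split; last first.
    apply: He; rewrite -ball_normE /= scalerBl scale1r opprB addrC subrK normrZ gtr0_norm //.
    by apply: le_lt_trans dle; rewrite ler_piMr ?W1 // ltW.
  apply/nbhs_ballP; exists (dl / K1) => /=; first exact: divr_gt0.
  move=> z; rewrite -ball_normE /= distrC => zy k.
  rewrite -[z](subrK ((1 - dl) *: y)) mulmxDr; apply: le_trans (ler_normD _ _) _.
  have h1 : `|D ^+ k *m (z - (1 - dl) *: y)| <= dl.
    by apply: le_trans (HK _ _) _; rewrite mulrC -ler_pdivlMr // ltW.
  have h2 : `|D ^+ k *m ((1 - dl) *: y)| <= 1 - dl.
    rewrite -scalemxAr normrZ ger0_norm ?subr_ge0 //.
    by rewrite ler_piMr ?subr_ge0 //; exact: Wy.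
  by apply: le_trans (lerD h1 h2) _; rewrite addrC subrK.
- by exists 0; apply: subset_closure => k; rewrite mulmx0 normr0.
Qed.

Section Assembly.
Variables (R : realType) (n m : nat) (A : 'M[R]_n) (M : 'M[int]_(n + m)).
Variables (B : 'M[R]_(n, n + m)) (F : 'M[R]_(n + m, n)).
Variables (E : 'M[R]_(m, n + m)) (G : 'M[R]_(n + m, m)).
Notation ir := (map_mx (intr : int -> R)).
Notation cx := (map_mx (real_complex R)).
Hypotheses (AB : A *m B = B *m ir M) (MF : ir M *m F = F *m A) (BF : B *m F = 1%:M).
Hypotheses (EF : E *m F = 0) (EG : E *m G = 1%:M) (BG : B *m G = 0).
Hypothesis FBGE : F *m B + G *m E = 1%:M.
Hypothesis Binj : forall r : 'cV[int]_(n + m), r != 0 -> B *m ir r != 0.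
Hypothesis Finj : forall z : 'rV[int]_(n + m), z != 0 -> ir z *m F != 0.
Hypothesis FBinj : forall r : 'cV[int]_(n + m), r != 0 -> F *m (B *m ir r) != ir r.
Let L := col_mx B E.
Let D := E *m ir M *m G.

Let Lunit : L \in unitmx.
Proof.
suff : L *m row_mx F G = 1%:M by move=> /mulmx1_unit[].
by rewrite mul_col_row BF BG EF EG -scalar_mx_block.
Qed.

Let EM : E *m ir M = D *m E.
Proof.
rewrite -[LHS]mulmx1 -FBGE mulmxDr mulmxA -[E *m ir M *m F]mulmxA MF mulmxA EF.
by rewrite !mul0mx add0r mulmxA.
Qed.

Let EMk k : E *m ir M ^+ k = D ^+ k *m E.
Proof.
elim: k => [|k IH]; first by rewrite !expr0 mulmx1 mul1mx.
by rewrite exprSr -mulmxE mulmxA IH -mulmxA EM mulmxA exprSr -mulmxE.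
Qed.

(** If [E r = 0] then [r = F B r], which [FBinj] excludes for nonzero [r]. If [u E = z] is integral
    then [z F = u E F = 0], so [Finj] gives the hypothesis of [kronecker]. *)
Lemma splitting_generic : generic_cps L.
Proof.
have par (r : 'cV[int]_(n + m)) : pi_par (L *m ir r) = B *m ir r.
  by rewrite /pi_par -mul_usub_mx col_mxKu.
have perp (r : 'cV[int]_(n + m)) : pi_perp (L *m ir r) = E *m ir r.
  by rewrite /pi_perp -mul_dsub_mx col_mxKd.
split.
- move=> _ _ /set_mem[r _ <-] /set_mem[r' _ <-]; rewrite !par => h.
  congr (L *m ir _); apply/eqP; rewrite -subr_eq0; apply/negPn/negP => /Binj.
  by rewrite map_mxB mulmxBr h subrr eqxx.
- move=> _ _ /set_mem[r _ <-] /set_mem[r' _ <-]; rewrite !perp => h.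
  congr (L *m ir _); apply/eqP; rewrite -subr_eq0; apply/negPn/negP => /FBinj/negP; apply.
  have E0 : E *m ir (r - r') = 0 by rewrite map_mxB mulmxBr h subrr.
  by apply/eqP; rewrite -[RHS]mul1mx -FBGE mulmxDl -!mulmxA E0 mulmx0 addr0.
- have KE (u : 'rV[R]_m) (z : 'rV[int]_(n + m)) : u *m E = ir z -> u = 0.
    move=> uE; have z0 : z = 0.
      apply/eqP/negPn/negP => /Finj; rewrite -uE -mulmxA EF mulmx0 eqxx //.
    by rewrite -[u]mulmx1 -EG mulmxA uE z0 map_mx0 mul0mx.
  move=> O [y Oy] oO; have /nbhs_ballP[e /= e0 He] : nbhs y O by exact: open_nbhs_nbhs.
  have [r Hr] := kronecker KE y e0.
  exists (E *m ir r); split; first by apply: He; rewrite -ball_normE /= distrC.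
  by exists (L *m ir r); [exists r | exact: perp].
Qed.

Variables (d : 'rV[R[i]]_(n + m)) (Q U : 'M[R[i]]_(n + m)).
Hypothesis QU : Q *m U = 1%:M.
Hypothesis MU : map_mx intr M *m U = U *m diag_mx d.
Hypothesis mult_eq : forall nu, 1 < `|nu| ->
  alg_mult (cmx A) nu = #|[pred l | d 0 l == nu]|.

Let cMir : cx (ir M) = map_mx intr M.
Proof. by apply/matrixP => i j; rewrite !mxE /= rmorph_int. Qed.

Let cDE : cx E *m map_mx intr M = cx D *m cx E.
Proof. by rewrite -cMir -!map_mxM EM. Qed.

(** The multiplicity of [nu] in [M] is the sum of those in [A] and [D], and [A] already accounts for
    all of it. *)
Let notroot nu : 1 < `|nu| -> ~~ eigenvalue (cx D) nu.
Proof.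
move=> nu1; have LM : L *m ir M = block_mx A 0 0 D *m L.
  by rewrite mul_col_mx mul_block_col !mul0mx addr0 add0r AB EM.
have UQ := mulmx1C QU.
have [uQ uU] := mulmx1_unit QU.
have QM : Q *m map_mx intr M = diag_mx d *m Q.
  by rewrite -[LHS]mulmx1 -UQ mulmxA -[Q *m _ *m U]mulmxA MU !mulmxA QU mul1mx.
have chiE : char_poly (map_mx intr M : 'M[R[i]]_(n + m)) = char_poly (cmx A) * char_poly (cx D).
  rewrite -cMir -!(map_char_poly (real_complex R)) -rmorphM /= -(char_poly_block A 0 D).
  by rewrite (char_poly_similar Lunit LM).
have := alg_mult_diag nu uQ QM; rewrite /alg_mult chiE mupM ?monic_neq0 ?char_poly_monic //.
rewrite -mult_eq // -[RHS]addn0 => /addnI h.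
by rewrite -alg_mult_gt0 /alg_mult h.
Qed.

(** [E] sends an eigenvector of [M] to an eigenvector of [D] for the same eigenvalue or to 0, and
    [notroot] leaves only 0. *)
Let EU0 l : 1 < `|d 0 l| -> cx E *m U *m delta_mx l (0 : 'I_1) = 0.
Proof.
move=> /notroot; set x := _ *m delta_mx _ _.
have Dx : cx D *m x = d 0 l *: x.
  have dd : diag_mx d *m delta_mx l (0 : 'I_1) = d 0 l *: delta_mx l 0.
    rewrite mul_diag_mx; apply/matrixP => i j; rewrite !mxE.
    by case: (i =P l) => [->|_]; rewrite ?mulr0.
  rewrite /x !mulmxA -cDE -[cx E *m _ *m U]mulmxA MU mulmxA.
  by rewrite -[_ *m diag_mx d *m _]mulmxA dd -scalemxAr.
rewrite /eigenvalue /eigenspace negbK kermx_eq0 row_free_unit => uD.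
apply: (can_inj (mulKmx uD)); rewrite mulmx0 mulmxBl Dx.
by rewrite mul_scalar_mx subrr.
Qed.

(** In [D ^ k = E U diag(d ^ k) Q G] the terms with [|d 0 l| > 1] vanish by [EU0], and the other
    powers have modulus at most 1. *)
Let Dbounded : exists K : R, forall k (y : 'cV[R]_m), `|D ^+ k *m y| <= K * `|y|.
Proof.
have UQ := mulmx1C QU.
pose nc (z : R[i]) : R := ComplexField.Normc.normc z.
have ncE z : `|z| = ((nc z)%:C)%C by [].
pose c i j : R := \sum_l nc ((cx E *m U) i l) * nc ((Q *m cx G) l j).
have diagX k : diag_mx d ^+ k = diag_mx (\row_j d 0 j ^+ k).
  elim: k => [|k IH]; last first.
    rewrite exprS IH -mulmxE mulmx_diag; congr diag_mx; apply/rowP => j.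
    by rewrite !mxE exprS.
  rewrite expr0; apply/matrixP => i j; rewrite !mxE expr0.
  by case: (_ == _).
have MUk k : (map_mx intr M) ^+ k *m U = U *m diag_mx d ^+ k.
  elim: k => [|k IH]; first by rewrite !expr0 mulmx1 mul1mx.
  by rewrite !exprS -!mulmxE -mulmxA IH mulmxA MU mulmxA.
have DkE k : cx (D ^+ k) = cx E *m U *m diag_mx (\row_j d 0 j ^+ k) *m (Q *m cx G).
  rewrite -diagX -[cx E *m U *m _]mulmxA -MUk !mulmxA -[_ *m U *m Q]mulmxA UQ mulmx1.
  have -> : map_mx intr M ^+ k = cx (ir M ^+ k).
    elim: k => [|k IH]; first by rewrite !expr0 map_mx1.
    by rewrite !exprS IH -!mulmxE map_mxM cMir.
  by rewrite -!map_mxM EMk -mulmxA EG mulmx1.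
have Dkc k i j : `|(D ^+ k) i j| <= c i j.
  have h : `|(cx (D ^+ k)) i j| <= ((c i j)%:C)%C.
    rewrite DkE mxE /c rmorph_sum /=; apply: le_trans (ler_norm_sum _ _ _) _.
    apply: ler_sum => l _; rewrite mul_mx_diag normrM [X in `|X| * _]mxE rmorphM /= -!ncE.
    rewrite ler_wpM2r // normrM [X in _ * `|X|]mxE normrX.
    have [dl|dl] := boolP (1 < `|d 0 l|).
      have -> : (cx E *m U) i l = 0.
        have /matrixP/(_ i 0) := EU0 dl.
        by rewrite -colE !mxE => ->.
      by rewrite normr0 mul0r.
    by rewrite ler_piMr // exprn_ile1 // real_leNgt ?num_real ?normr_real ?real1.
  move: h; rewrite mxE ncE lecR /nc /= expr0n /= addr0 sqrtr_sqr //.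
exists (\sum_i \sum_j c i j) => k y; apply: le_trans (mulmx_norm_le _ _) _.
by rewrite ler_wpM2r // ler_sum // => i _; rewrite ler_sum.
Qed.

Lemma splitting_cps : exists W : set 'cV[R]_m,
  [/\ L \in unitmx, generic_cps L, window W &
      forall x, cps_set L W x -> cps_set L W (A *m x)].
Proof.
have [K HK] := Dbounded.
exists [set y | forall k, `|D ^+ k *m y| <= 1]; split.
- exact: Lunit.
- exact: splitting_generic.
- exact: power_bounded_window HK.
move=> _ [_ [[r _ <-] Wr] <-].
exists (L *m ir (M *m r)); last first.
  by rewrite /pi_par -!mul_usub_mx col_mxKu map_mxM !mulmxA AB.
split; first by exists (M *m r).
(* The condition on [D y] at exponent [k] is the one on [y] at exponent [k.+1]. *)
move=> k; have := Wr k.+1; rewrite /pi_perp -!mul_dsub_mx col_mxKd.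
by rewrite map_mxM [E *m (_ *m _)]mulmxA EM exprSr -mulmxE !mulmxA.
Qed.

End Assembly.

Lemma spectrum_dilation (R : realType) (n : nat) (A : 'M[R]_n) :
  (0 < n)%N -> diagonalizable (cmx A) ->
  (forall l : R[i], eigenvalue (cmx A) l -> algebraic_integer l) ->
  (forall mu : R[i], 1 < `|mu| ->
      (exists l : R[i], eigenvalue (cmx A) l /\ alg_conjugate l mu) ->
      (forall nu : R[i], alg_conjugate mu nu ->
            (alg_mult (cmx A) nu <= alg_mult (cmx A) mu)%N) /\
      (exists nu : R[i], alg_conjugate mu nu /\
            (alg_mult (cmx A) nu < alg_mult (cmx A) mu)%N)) ->
  exists (m : nat) (L : 'M[R]_(n + m)) (W : set 'cV[R]_m),
      [/\ (0 < m)%N, L \in unitmx, generic_cps L, window W &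
          forall x, cps_set L W x -> cps_set L W (A *m x)].
Proof.
move=> n0 [QA uQA /diagonalizable_forPex[a /(simmxP uQA) QAA]] P1 P2.
have multA nu : alg_mult (cmx A) nu = #|[pred i | a 0 i == nu]| := alg_mult_diag nu uQA QAA.
have eigA i : eigenvalue (cmx A) (a 0 i).
  by rewrite -alg_mult_gt0 multA; apply/card_gt0P; exists i; rewrite inE.
have [||ps [psI ps_le ps_big ps_root ps_lt]] := class_list_exists (a := a 0).
- by move=> i; apply: P1.
- move=> mu mu1 [i ci]; have [|H1 [nu [cnu H2]]] := P2 mu mu1.
    by exists (a 0 i).
  split; first by move=> nu' cnu'; rewrite -!multA; exact: H1.
  by exists nu; rewrite -!multA.
have [s [M [d [Q [U SP]]]]] := int_spectral_exists R[i] psI.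
have [QU MU cnt _ _] := SP.
have AUA : cmx A *m invmx QA = invmx QA *m diag_mx a.
  have <- : QA *m (cmx A *m invmx QA) = diag_mx a by rewrite mulmxA QAA mulmxK.
  by rewrite mulKmx.
have [||B [F [AB MF BF Binj [Finj FBinj]]]] :=
    generic_splitting (A := A) (mulmxV uQA) AUA SP _ ps_root _.
- by move=> nu; rewrite cnt.
- by move=> p /ps_lt[nu [pnu lt]]; exists nu; rewrite cnt.
have [m [E [G [nm EF EG BG FBGE]]]] := split_complement BF.
subst s.
(* If [m] were 0, then [F B] would be the identity, against [FBinj] at a basis vector. *)
have m0 : (0 < m)%N.
  rewrite lt0n; apply/negP => /eqP m0; subst m.
  have i0 : 'I_(n + 0) by rewrite addn0; exact: Ordinal n0.
  have r0 : delta_mx i0 0 != 0 :> 'cV[int]_(n + 0).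
    by apply/eqP => /matrixP/(_ i0 0); rewrite !mxE !eqxx => /eqP; rewrite oner_eq0.
  have := FBinj _ r0; have : G *m E = 0 by rewrite [E]flatmx0 mulmx0.
  by move=> GE0; move: FBGE; rewrite GE0 addr0 mulmxA => ->; rewrite mul1mx eqxx.
have big nu : 1 < `|nu| -> alg_mult (cmx A) nu = #|[pred l | d 0 l == nu]|.
  by move=> nu1; rewrite multA cnt ps_big.
have [W [uL gL wW AW]] := splitting_cps AB MF BF EF EG BG FBGE Binj Finj FBinj QU MU big.
by exists m, (col_mx B E), W.
Qed.

Theorem theorem4 (R : realType) (n : nat) (A : 'M[R]_n) :
  (0 < n)%N -> A \in unitmx -> diagonalizable (cmx A) ->
  (exists (m : nat) (L : 'M[R]_(n + m)) (W : set 'cV[R]_m),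
      [/\ (0 < m)%N, L \in unitmx, generic_cps L, window W &
          forall x, cps_set L W x -> cps_set L W (A *m x)])
  <->
  ((forall l : R[i], eigenvalue (cmx A) l -> algebraic_integer l) /\
   (forall mu : R[i], 1 < `|mu| ->
      (exists l : R[i], eigenvalue (cmx A) l /\ alg_conjugate l mu) ->
      [/\ eigenvalue (cmx A) mu,
          forall nu : R[i], alg_conjugate mu nu ->
            (alg_mult (cmx A) nu <= alg_mult (cmx A) mu)%N &
          exists nu : R[i], alg_conjugate mu nu /\
            (alg_mult (cmx A) nu < alg_mult (cmx A) mu)%N])).
Proof.
move=> n0 _ dA; split=> [[m [L [W [m0 uL gL wW AW]]]]|[P1 P2]].
  exact: dilation_spectrum n0 m0 uL gL wW AW.
apply: (spectrum_dilation n0 dA P1) => mu mu1 cmu.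
by have [_ H1 H2] := P2 mu mu1 cmu.
Qed.
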